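(* Let $X$ be a length space, and for $x,y\in\widetilde{X}$ let $d(x,y)=\inf\{L(\phi\circ\gamma)\}$ (infimum over all paths $\gamma$ in $\widetilde{X}$ joining $x$ and $y$, the infimum of the empty set being $\infty$). The function $d$ defines a (finite) length space metric on the metric core $\widehat{X}$ such that: (1) The inclusion of $\widehat{X}$ with this metric into $\widetilde{X}$ is uniformly continuous. (2) If $Y$ is a length space and $g:Y\rightarrow\widetilde{X}$ is a function such that $g(Y)\cap\widehat{X}\neq\varnothing$ and $\phi\circ g$ is $1$-Lipschitz, then $g(Y)\subset\widehat{X}$ and $g$ is $1$-Lipschitz (hence continuous) in the metric of $\widehat{X}$. (3) Every $1$-Lipschitz homotopy between rectifiable paths in $X$ lifts to $\widehat{X}$, and in particular $\widehat{\phi}$ is a URL($H_L$)-map. (4) If $X$ is complete then $\widehat{X}$ is complete. (5) The group $\mu(X)$ is the stabilizer of $\widehat{X}$ in the uniform fundamental group $\delta(X)$ and acts isometrically and freely on $\widehat{X}$ with metric quotient $\mu(X)\backslash\widehat{X}=X$.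
   Context: A length space is a metric space with at least two points in which any two points are joined by paths (continuous maps from compact intervals) of length arbitrarily close to their distance; $L(c)$ is the length of $c$. Uniform universal cover. Fix a basepoint $\ast\in X$. For $\varepsilon>0$, an $\varepsilon$-chain is a finite sequence $\{x_0,\dots,x_n\}$ in $X$ with $d(x_i,x_{i+1})<\varepsilon$; it is an $\varepsilon$-loop if $x_0=x_n$. Two $\varepsilon$-chains with the same endpoints are $\varepsilon$-homotopic if one is obtained from the other by finitely many steps, each adding or removing a single point (endpoints kept) and leaving an $\varepsilon$-chain at each step; $[\gamma]_\varepsilon$ is the class of $\gamma$. $X_\varepsilon$ is the set of classes of $\varepsilon$-chains starting at $\ast$. The endpoint map $X_\varepsilon\to X$ is a covering map, and $X_\varepsilon$ carries the lifted length metric, for which it is a length space and the endpoint map is a local isometry (points $[x_0,\dots,x_n]_\varepsilon$ and $[x_0,\dots,x_n,y]_\varepsilon$ with $d(x_n,y)$ sufficiently small being at distance $d(x_n,y)$). For $\delta<\varepsilon$ the map $\phi_{\varepsilon\delta}:X_\delta\to X_\varepsilon$, $[\gamma]_\delta\mapsto[\gamma]_\varepsilon$, gives an inverse system; $\widetilde{X}$ is its inverse limit with the inverse limit uniform structure, and $\phi:\widetilde{X}\to X$ sends $([\gamma_\varepsilon]_\varepsilon)$ to the common endpoint of the $\gamma_\varepsilon$. The basepoint $\ast$ of $\widetilde{X}$ is the element of trivial chains. The uniform fundamental group $\delta(X)$ is the set of $([\gamma_\varepsilon]_\varepsilon)\in\widetilde{X}$ with every $\gamma_\varepsilon$ an $\varepsilon$-loop,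 with concatenation as group operation; it acts on $\widetilde{X}$ by concatenation. Every path $\alpha$ in $X$ starting at $\ast$ has a unique lift $\alpha_L$ to $\widetilde{X}$ starting at $\ast$. The homomorphism $\lambda:\pi_1(X)\to\delta(X)$ sends $[\alpha]$ to the unique element of $\delta(X)$ carrying $\ast$ to the endpoint of $\alpha_L$. Metric core. With $d$ as in the claim, $\widehat{X}:=\{x\in\widetilde{X}:d(x,\ast)<\infty\}$ is the metric core, and $\widehat{\phi}:=\phi|_{\widehat{X}}$. $\mu_1(X)\subset\pi_1(X)$ is the subgroup of homotopy classes with a rectifiable representative, and $\mu(X):=\lambda(\mu_1(X))\subset\delta(X)$. URL-maps. A function $f:Z\to X$ between length spaces is a URL-map if: (I) $L(c)=L(f\circ c)$ for every path $c$ in $Z$ of finite length; (II) if $c$ is a rectifiable path in $X$ starting at $p$ and $f(q)=p$, there is a unique path $c_L$ in $Z$ starting at $q$ with $f\circ c_L=c$, and $c_L$ is rectifiable. A path $c:[a,b]\to X$ is weakly normal if there is no nontrivial subsegment $J=[u,v]$ with $c(u)=c(v)$ and $c|_J$ homotopic in $c(J)$ to a constant relative to $\{u,v\}$. A $\rho$-path ($\rho$-loop) is a weakly normal rectifiable arclength parameterized path (loop); constant paths with one-point domain are allowed. The cancelled concatenation of $\rho$-paths $c,d$ (with $d$ starting where $c$ ends) is the unique $\rho$-path in the image of the concatenation $c\ast d$ that is fixed-endpoint homotopic to $c\ast d$ in that image. $\Lambda(X)$ is the group of $\rho$-loops at $\ast$ under cancelled concatenation, and $H_L\subset\Lambda(X)$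 is the subgroup of $\rho$-loops that are null-homotopic via a $1$-Lipschitz homotopy. For a subgroup $G\subset\Lambda(X)$, a basepoint preserving URL-map is URL($G$) if the lift at the basepoint of every $c\in G$ is a loop. A lift of a homotopy $h$ to $\widehat{X}$ is a homotopy $\widehat{h}$ in $\widehat{X}$ with $\widehat{\phi}\circ\widehat{h}=h$, for a prescribed starting point in $\widehat{X}$. If a group $G$ acts by isometries on a metric space $M$ with closed orbits, the quotient metric on the orbit space is $d(Gx,Gy)=\inf\{d(g(x),y):g\in G\}$; the equality $\mu(X)\backslash\widehat{X}=X$ is an isometry induced by $\widehat{\phi}$.
   Formalization: In (2) the function g is additionally assumed continuous into the uniform universal cover; without this the claim fails (on a circle, let g jump by a deck translation at rational points), and the conclusion itself forces this continuity. *)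

(* Defs.v *)
From HB Require Import structures.
From Stdlib Require Import Relation_Operators.
From mathcomp Require Export all_boot all_order all_algebra.
From mathcomp Require Export generic_quotient.
From mathcomp Require Export all_classical all_reals.
From mathcomp Require Export topology normedtype numfun ereal.

Set Implicit Arguments.
Unset Strict Implicit.
Unset Printing Implicit Defensive.

Import Order.TTheory GRing.Theory Num.Theory.
Export numFieldNormedType.Exports.

Global Open Scope classical_set_scope.
Global Open Scope ring_scope.

Section Paths.
Context {R : realType}.

Definition path_on {T : topologicalType} (a b : R) (c : R -> T) : Prop :=
  a <= b /\ {within `[a, b], continuous c}.

Section Length.
Context {T : metricType R}.
Implicit Types (a b : R) (c : R -> T) (s : seq R).

(* The points of the partition are a :: s; zip pairs each with its successor. *)
Definition polygonal_length c a s : R :=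
  \sum_(p <- zip (a :: s) s) mdist (c p.1) (c p.2).

Definition path_length a b c : \bar R :=
  ereal_sup [set (polygonal_length c a s)%:E | s in itv_partition a b].

Definition rectifiable a b c : Prop :=
  path_on a b c /\ (path_length a b c < +oo)%E.

End Length.

Definition length_space (X : metricType R) : Prop :=
  (exists x y : X, x != y) /\
  forall (x y : X) (e : R), 0 < e ->
    exists (a b : R) (c : R -> X),
      [/\ path_on a b c, c a = x, c b = y &
          (path_length a b c <= (mdist x y + e)%:E)%E].

(* Both the lifted length metric of X_eps and the distance d on the uniform   *)
(* universal cover are instances.                                             *)
Definition lifted_dist {T : topologicalType} {X : metricType R} (f : T -> X)
    (x y : T) : \bar R :=
  ereal_inf [set l | exists (a b : R) (c : R -> T),
    [/\ path_on a b c, c a = x, c b = y & l = path_length a b (f \o c)]].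

Definition is_lift {T X : topologicalType} (f : T -> X) (a b : R)
    (c : R -> X) (cL : R -> T) : Prop :=
  path_on a b cL /\ {in `[a, b], forall t, f (cL t) = c t}.

Definition path_homotopic_in {T : topologicalType} (A : set T) (a b : R)
    (c c' : R -> T) : Prop :=
  exists H : R * R -> T,
    [/\ {within `[a, b] `*` `[0, 1], continuous H},
        forall t s, t \in `[a, b] -> s \in `[0, 1] -> A (H (t, s)),
        {in `[a, b], forall t, H (t, 0) = c t /\ H (t, 1) = c' t} &
        {in `[0, 1], forall s, H (a, s) = c a /\ H (b, s) = c b}].

End Paths.

Section LengthTheory.
Context {R : realType}.

Lemma path_on_comp {T : topologicalType} (a b a' b' : R) (c : R -> T)
    (f : R -> R) : a <= b -> continuous f ->
  (forall t, a <= t <= b -> a' <= f t <= b') ->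
  path_on a' b' c -> path_on a b (c \o f).
Proof.
move=> ab cf fab [ab' /subspace_continuousP cc]; split=> //.
apply/subspace_continuousP => x xab.
have fx : `[a', b']%classic (f x).
  by move: xab; rewrite /= !in_itv /=; exact: fab.
apply: (@cvg_comp _ _ _ f c _ (within `[a', b']%classic (nbhs (f x))));
  last exact: cc.
move=> W /= Wx.
have := cf x _ Wx; rewrite /within /= !nbhs_simpl /=.
apply: (@filterS _ (nbhs x)) => z /= + zab; apply.
by move: zab; rewrite !in_itv /=; exact: fab.
Qed.

Context {T : metricType R}.
Implicit Types (a b : R) (c : R -> T) (s : seq R).

Lemma polygonal_length_nil c a : polygonal_length c a [::] = 0.
Proof. by rewrite /polygonal_length big_nil. Qed.

Lemma polygonal_length_cons c a x s :
  polygonal_length c a (x :: s) = mdist (c a) (c x) + polygonal_length c x s.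
Proof. by rewrite /polygonal_length big_cons. Qed.

Lemma polygonal_length_rcons c a x s : polygonal_length c a (rcons s x) =
  polygonal_length c a s + mdist (c (last a s)) (c x).
Proof.
elim: s a => [|y s IH] a /=.
  by rewrite polygonal_length_cons !polygonal_length_nil addr0 add0r.
by rewrite !polygonal_length_cons IH addrA.
Qed.

Lemma last_rev_belast (S : Type) (x : S) (s : seq S) :
  last (last x s) (rev (belast x s)) = x.
Proof. by case: s => // y s; rewrite /= rev_cons last_rcons. Qed.

Lemma polygonal_length_rev c a s :
  polygonal_length c (last a s) (rev (belast a s)) = polygonal_length c a s.
Proof.
elim: s a => [|x s IH] a; first by rewrite !polygonal_length_nil.
rewrite /= rev_cons polygonal_length_rcons IH last_rev_belast.
by rewrite polygonal_length_cons addrC metric_sym.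
Qed.

Lemma polygonal_length_map c c' (f : R -> R) a s :
  {in a :: s, forall t, c t = c' (f t)} ->
  polygonal_length c a s = polygonal_length c' (f a) (map f s).
Proof.
elim: s a => [|x s IH] a h; first by rewrite !polygonal_length_nil.
rewrite /= !polygonal_length_cons -IH; last by move=> t ts; apply: h; rewrite inE ts orbT.
by rewrite !h // !inE eqxx ?orbT.
Qed.

Lemma itv_partition_bounds a b s :
  itv_partition a b s -> {in a :: s, forall t, a <= t <= b}.
Proof.
elim: s a => [|x s IH] a [/= p /eqP l] t.
  by rewrite inE => /eqP ->; rewrite -l lexx.
case/andP: p => ax p.
have {}IH := IH x (conj p (introT eqP l)).
rewrite inE => /orP[/eqP ->|ts].
  have /andP[_ xb] := IH x (mem_head _ _).
  by rewrite lexx (le_trans (ltW ax)).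
by have /andP[xt ->] := IH t ts; rewrite (le_trans (ltW ax)).
Qed.

Lemma path_length_comp_le (a b a' b' : R) c c' (f : R -> R) :
  {homo f : x y / x < y} -> f a = a' -> f b = b' ->
  (forall t, a <= t <= b -> c t = c' (f t)) ->
  (path_length a b c <= path_length a' b' c')%E.
Proof.
move=> fi fa fb cc'; apply: ge_ereal_sup => _ [s sp <-].
apply: ereal_sup_ubound; exists (map f s).
  case: sp => p /eqP l; split; last by rewrite -fa last_map l fb.
  by rewrite -fa; exact: (homo_path (e := <%O)).
rewrite -fa -(@polygonal_length_map c c') // => t /(itv_partition_bounds sp).
exact: cc'.
Qed.

Lemma path_length_rev (a b : R) c :
  (path_length (- b) (- a) (c \o -%R) <= path_length a b c)%E.
Proof.
apply: ge_ereal_sup => _ [s [p /eqP l] <-].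
apply: ereal_sup_ubound; exists (map -%R (rev (belast (- b) s))).
  split; last first.
    by rewrite -[X in last X _]opprK last_map -l last_rev_belast opprK.
  rewrite -[X in path _ X _]opprK -l path_map rev_path.
  by rewrite (eq_path (e' := <%R)) // => x y /=; rewrite ltrN2.
rewrite -[X in polygonal_length _ X _]opprK -(@polygonal_length_map (c \o -%R)).
  by rewrite -l polygonal_length_rev.
by move=> t _ /=.
Qed.

Lemma path_length_split (a b e : R) c : a <= b -> b <= e ->
  (path_length a e c <= path_length a b c + path_length b e c)%E.
Proof.
move=> ab be; apply: ge_ereal_sup => _ [s sp <-].
suff [s1 [s2 [p1 p2 le]]] : exists s1 s2, [/\ itv_partition a b s1,
    itv_partition b e s2 &
    polygonal_length c a s <= polygonal_length c a s1 + polygonal_length c b s2].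
  apply: (@le_trans _ _ (polygonal_length c a s1 + polygonal_length c b s2)%:E).
    by rewrite lee_fin.
  by rewrite EFinD leeD //; apply: ereal_sup_ubound; [exists s1|exists s2].
elim: s a ab sp => [|x s IH] a ab [/= p /eqP l].
  have ea : b = a by apply/eqP; rewrite eq_le ab l be.
  exists [::], [::]; rewrite ea.
  by split; [split|split; rewrite /= ?l|rewrite !polygonal_length_nil addr0].
case/andP: p => ax p; have [xb|bx] := leP x b.
  have [s1 [s2 [[p1 l1] p2 le]]] := IH x xb (conj p (introT eqP l)).
  exists (x :: s1), s2; split => //; first by split; rewrite /= ?ax.
  by rewrite !polygonal_length_cons -addrA lerD2l.
have p2 : itv_partition b e (x :: s) by split; rewrite /= ?bx ?l.
move: ab; rewrite le_eqVlt => /predU1P[eab|ab].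
  exists [::], (x :: s); rewrite -eab in p2 *.
  by split; [split| |rewrite polygonal_length_nil add0r].
exists [:: b], (x :: s).
split; [by split; rewrite /= ?ab|by []|].
rewrite !polygonal_length_cons polygonal_length_nil addr0 addrA lerD2r.
exact: metric_triangle.
Qed.

End LengthTheory.

Section LiftedDist.
Context {R : realType} {T : topologicalType} {X : metricType R} (f : T -> X).

Lemma lifted_dist_lt (x y : T) (e : \bar R) : (lifted_dist f x y < e)%E ->
  exists (a b : R) (c : R -> T), [/\ path_on a b c, c a = x, c b = y &
    (path_length a b (f \o c) < e)%E].
Proof.
by move=> /ereal_inf_lt[_ [a [b [c [h1 h2 h3 ->]]]] h]; exists a, b, c.
Qed.

Lemma lifted_dist_le (x y : T) (a b : R) (c : R -> T) :
  path_on a b c -> c a = x -> c b = y ->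
  (lifted_dist f x y <= path_length a b (f \o c))%E.
Proof. by move=> h1 h2 h3; apply: ereal_inf_lbound; exists a, b, c. Qed.

Lemma lifted_distxx (x : T) : (lifted_dist f x x <= 0)%E.
Proof.
apply: le_trans (_ : (path_length 0 0 (f \o cst x) <= 0)%E).
  apply: lifted_dist_le => //; split=> //.
  by apply: continuous_subspaceT => y; exact: cvg_cst.
apply: ge_ereal_sup => _ [s [p /eqP l] <-]; case: s p l => [|y s] p l.
  by rewrite polygonal_length_nil.
have := itv_partition_bounds (conj p (introT eqP l)) (x := y).
rewrite !inE eqxx orbT => /(_ isT) /andP[_ y0].
by move: p => /= /andP[/lt_le_trans/(_ y0)]; rewrite ltxx.
Qed.

Lemma lifted_dist_sym_lt (x y : T) (e : \bar R) :
  (lifted_dist f x y < e)%E -> (lifted_dist f y x < e)%E.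
Proof.
move=> /lifted_dist_lt[a [b [c [pc ca cb le]]]].
apply: le_lt_trans le; apply: le_trans (path_length_rev a b (f \o c)).
apply: (@lifted_dist_le _ _ (- b) (- a) (c \o -%R)); rewrite /= ?opprK //.
have ab := pc.1; apply: path_on_comp pc; rewrite ?lerN2 //.
  exact: opp_continuous.
by move=> t; rewrite lerNl lerNr andbC.
Qed.

Lemma lifted_dist_triangle_lt (x y z : T) (e1 e2 : R) :
  (lifted_dist f x y < e1%:E)%E -> (lifted_dist f y z < e2%:E)%E ->
  (lifted_dist f x z < (e1 + e2)%:E)%E.
Proof.
move=> /lifted_dist_lt[a [b [c [pc ca cb le]]]].
move=> /lifted_dist_lt[a' [b' [c' [pc' ca' cb' le']]]].
have [ab ab'] := (pc.1, pc'.1).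
pose sh t := t - b + a'; pose e := b' - a' + b.
pose g t := if t <= b then c t else c' (sh t).
have be : b <= e by rewrite lerDr subr_ge0.
have she : sh e = b' by rewrite /sh /e addrK subrK.
have shb : sh b = a' by rewrite /sh subrr add0r.
have gl t : a <= t <= b -> g t = c t by rewrite /g => /andP[_ ->].
have gr t : b <= t <= e -> g t = c' (sh t).
  rewrite /g => /andP[bt _]; case: leP => // tb.
  have -> : t = b by apply/eqP; rewrite eq_le bt tb.
  by rewrite shb cb ca'.
have shc : continuous sh.
  move=> t; apply: cvgD; last exact: cvg_cst.
  by apply: cvgB; [exact: cvg_id|exact: cvg_cst].
have shm : {homo sh : u v / u < v} by move=> u v uv; rewrite /sh !ltrD2r.
have pgl : {within `[a, b], continuous g}.
  apply: subspace_eq_continuous pc.2 => t; rewrite inE /= in_itv /= => tab.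
  by rewrite /from_subspace gl.
have pgr : {within `[b, e], continuous g}.
  have pcs : path_on b e (c' \o sh).
    apply: path_on_comp pc' => // t /andP[bt te].
    by rewrite -shb -she /sh !lerD2r bt te.
  apply: subspace_eq_continuous pcs.2 => t; rewrite inE /= in_itv /= => tab.
  by rewrite /from_subspace gr.
have pg : path_on a e g.
  split; first exact: le_trans be.
  apply: (@continuous_subspaceW _ _ _ (`[a, b] `|` `[b, e])).
    move=> t /=; rewrite !in_itv /= => /andP[at_ te].
    by have [tb|bt] := leP t b; [left; rewrite at_|right; rewrite (ltW bt)].
  by apply: withinU_continuous => //; exact: interval_closed.
apply: (@le_lt_trans _ _ (path_length a e (f \o g))).
  apply: lifted_dist_le => //; first by rewrite gl ?lexx.
  by rewrite gr ?lexx ?be // she.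
apply: (le_lt_trans (path_length_split _ ab be)).
rewrite EFinD; apply: lteD.
  apply: le_lt_trans le; apply: (path_length_comp_le (f := id)) => // t tab.
  by rewrite /= gl.
apply: le_lt_trans le'; apply: (path_length_comp_le (f := sh)) => // t tab.
by rewrite /= gr.
Qed.

End LiftedDist.

Section ChainHomotopy.
Context {R : realType} {X : metricType R}.
Implicit Types (e : R) (x y : X) (s t u v : seq X).

(* The chain {x, s_0, ..., s_(n-1)} is encoded by its first point x and the   *)
(* sequence s; it is an e-chain when path (close e) x s, and ends at last x s.*)
Definition close e : rel X := fun x y => mdist x y < e.

(* Adds one point; removals are the inverse steps.                            *)
Definition chain_step e x s t : Prop :=
  [/\ path (close e) x s, path (close e) x t, last x s = last x t &
      exists (s1 : seq X) (y : X) (s2 : seq X),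
        s = s1 ++ s2 /\ t = s1 ++ y :: s2].

Definition chain_homotopic e x : seq X -> seq X -> Prop :=
  clos_refl_sym_trans (seq X) (chain_step e x).

Definition chain_rev x s := rev (belast x s).

Lemma chain_homotopic_last e x s t :
  chain_homotopic e x s t -> last x s = last x t.
Proof. by elim=> // [? ? []|? ? ? _ -> _]. Qed.

Lemma chain_homotopic_catl e x s u v : path (close e) x s ->
  chain_homotopic e (last x s) u v -> chain_homotopic e x (s ++ u) (s ++ v).
Proof.
move=> ps; elim=> [{}u {}v [pu pv l [s1 [y [s2 [uE vE]]]]]|{}u|{}u {}v _ h|].
- apply: rst_step; split.
  + by rewrite cat_path ps.
  + by rewrite cat_path ps.
  + by rewrite !last_cat.
  + by exists (s ++ s1), y, s2; rewrite uE vE !catA.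
- exact: rst_refl.
- exact: rst_sym.
- by move=> u1 u2 u3 _ h1 _ h2; exact: rst_trans h1 h2.
Qed.

Lemma chain_homotopic_catr e x s t u : path (close e) (last x s) u ->
  chain_homotopic e x s t -> chain_homotopic e x (s ++ u) (t ++ u).
Proof.
move=> + h; elim: h => {s t} [s t [ps pt l [s1 [y [s2 [sE tE]]]]]|s|s t h IH|].
- move=> pu; apply: rst_step; split.
  + by rewrite cat_path ps.
  + by rewrite cat_path pt -l.
  + by rewrite !last_cat l.
  + by exists s1, y, (s2 ++ u); rewrite sE tE -!catA.
- by move=> _; exact: rst_refl.
- by rewrite -(chain_homotopic_last h) => /IH; exact: rst_sym.
- move=> s1 s2 s3 h1 IH1 _ IH2 pu; apply: rst_trans (IH1 pu) (IH2 _).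
  by rewrite -(chain_homotopic_last h1).
Qed.

Lemma closeW e e' : e <= e' -> subrel (close e) (close e').
Proof. by move=> ee' x y /lt_le_trans; exact. Qed.

Lemma chain_homotopicW e e' x s t : e <= e' ->
  chain_homotopic e x s t -> chain_homotopic e' x s t.
Proof.
move=> ee'; elim=> {s t} [s t [ps pt l st]|s|s t _ h|s t u _ h1 _ h2].
- by apply: rst_step; split=> //; apply: sub_path (closeW ee') _ _ _.
- exact: rst_refl.
- exact: rst_sym.
- exact: rst_trans h1 h2.
Qed.

Lemma close_sym e : symmetric (close e).
Proof. by move=> x y; rewrite /close metric_sym. Qed.

Lemma path_chain_rev e x s :
  path (close e) (last x s) (chain_rev x s) = path (close e) x s.
Proof. by rewrite rev_path; apply: eq_path => y z; rewrite close_sym. Qed.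

Lemma chain_revK x s : chain_rev (last x s) (chain_rev x s) = s.
Proof.
rewrite /chain_rev; case: s => // y s /=.
by rewrite rev_cons belast_rcons rev_cons revK -lastI.
Qed.

Lemma chain_homotopic_detour e x y :
  mdist x y < e -> chain_homotopic e x [:: y; x] [::].
Proof.
move=> xy; have xx : close e x x.
  by rewrite /close mdistxx (le_lt_trans (mdist_ge0 x y)).
apply: (@rst_trans _ _ _ [:: x]); apply: rst_sym; apply: rst_step.
  split; rewrite /= ?xx ?andbT //=; last by exists [::], y, [:: x].
  by rewrite (close_sym e y x) /close xy.
by split; rewrite /= ?xx //; exists [::], x, [::].
Qed.

Lemma chain_homotopic_revr e x s : path (close e) x s ->
  chain_homotopic e x (s ++ chain_rev x s) [::].
Proof.
elim: s x => [x _|y s IH x /= /andP[xy ps]]; first exact: rst_refl.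
have -> : chain_rev x (y :: s) = rcons (chain_rev y s) x by rewrite /chain_rev /= rev_cons.
rewrite -cats1 catA; apply: rst_trans (chain_homotopic_detour xy).
apply: (@chain_homotopic_catr _ _ (y :: _) [:: y]).
  by rewrite /= last_cat last_rev_belast andbT close_sym.
apply: (@chain_homotopic_catl _ _ [:: y] _ [::]); first by rewrite /= xy.
exact: IH.
Qed.

Lemma chain_homotopic_revl e x s : path (close e) x s ->
  chain_homotopic e (last x s) (chain_rev x s ++ s) [::].
Proof.
move=> ps; have := @chain_homotopic_revr e (last x s) (chain_rev x s).
by rewrite path_chain_rev chain_revK; exact.
Qed.

End ChainHomotopy.

Section Cover.
Context {R : realType} {X : metricType R}.

Definition chain (pt : X) (e : {posnum R}) : Type :=
  {s : seq X | path (close e%:num) pt s}.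
HB.instance Definition _ pt e := SubChoice.on (chain pt e).

Context (pt : X) (e : {posnum R}).
Implicit Types s t u : chain pt e.

Definition chain_end s : X := last pt (val s).

Definition chain_equiv : rel (chain pt e) :=
  fun s t => `[< chain_homotopic e%:num pt (val s) (val t) >].

Lemma chain_equiv_refl : reflexive chain_equiv.
Proof. by move=> s; apply/asboolP; exact: rst_refl. Qed.

Lemma chain_equiv_sym : symmetric chain_equiv.
Proof. by move=> s t; apply/asboolP/asboolP; exact: rst_sym. Qed.

Lemma chain_equiv_trans : transitive chain_equiv.
Proof. by move=> t s u /asboolP h1 /asboolP h2; apply/asboolP; exact: rst_trans h1 h2. Qed.

Canonical chain_equiv_equiv_rel :=
  EquivRel chain_equiv chain_equiv_refl chain_equiv_sym chain_equiv_trans.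

Local Open Scope quotient_scope.

(* X_eps with the topology that makes the endpoint map a covering map         *)
Definition chain_cover : Type := {eq_quot chain_equiv}.
HB.instance Definition _ := Choice.on chain_cover.
HB.instance Definition _ := EqQuotient.on chain_cover.

Definition chain_mk (s : chain pt e) : chain_cover := \pi_chain_cover s.

Lemma chain_mkP s t :
  chain_mk s = chain_mk t <-> chain_homotopic e%:num pt (val s) (val t).
Proof. by split=> [/eqmodP/asboolP|/asboolP h]; last exact/eqmodP. Qed.

Lemma chain_mk_repr (p : chain_cover) : chain_mk (repr p) = p.
Proof. exact: reprK. Qed.

Definition endpoint (p : chain_cover) : X := chain_end (repr p).

Lemma endpointE s : endpoint (chain_mk s) = chain_end s.
Proof.
by apply/chain_homotopic_last/chain_mkP; rewrite chain_mk_repr.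
Qed.

(* pairs ([x_0, ..., x_n], [x_0, ..., x_n, y]) with mdist x_n y < r           *)
Definition cover_ball (r : R) : set (chain_cover * chain_cover) :=
  [set pq | exists (s t : chain pt e) (y : X),
    [/\ pq = (chain_mk s, chain_mk t), val t = rcons (val s) y &
        mdist (chain_end s) y < r]].

Definition cover_entourage : set_system (chain_cover * chain_cover) :=
  filter_from [set r | 0 < r <= e%:num] cover_ball.

End Cover.

Section ChainHomotopyShort.
Context {R : realType} {X : metricType R}.
Implicit Types (e : R) (x y z : X).

Lemma chain_homotopic_stutter e x : 0 < e -> chain_homotopic e x [:: x] [::].
Proof.
move=> e0; apply: rst_sym; apply: rst_step.
by split; rewrite /= /close ?mdistxx ?e0 //; exists [::], x, [::].
Qed.

Lemma chain_homotopic_shortcut e x y z : mdist x y < e -> mdist y z < e ->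
  mdist x z < e -> chain_homotopic e x [:: y; z] [:: z].
Proof.
move=> xy yz xz; apply: rst_sym; apply: rst_step.
by split; rewrite /= /close ?xy ?yz ?xz //; exists [::], y, [:: z].
Qed.

End ChainHomotopyShort.

Section CoverUniform.
Context {R : realType} {X : metricType R} (pt : X) (e : {posnum R}).
Local Notation ent := (@cover_entourage R X pt e).
Local Open Scope relation_scope.

Lemma chain_rcons_ex (s : chain pt e) (y : X) : mdist (chain_end s) y < e%:num ->
  exists t : chain pt e, val t = rcons (val s) y.
Proof.
move=> sy; have h : path (close e%:num) pt (rcons (val s) y).
  by rewrite rcons_path (valP s).
by exists (exist (fun u => is_true (path (close e%:num) pt u)) _ h).
Qed.

Lemma cover_entourage_filter : Filter ent.
Proof.
apply: filter_from_filter.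
  by exists e%:num; rewrite /= lexx andbT.
move=> r1 r2 /= /andP[r10 r1e] /andP[r20 r2e]; exists (Num.min r1 r2).
  by rewrite /= lt_min r10 r20 ge_min r1e.
move=> pq [s [t [y [-> tE]]]]; rewrite lt_min => /andP[h1 h2].
by split; exists s, t, y.
Qed.

Lemma cover_entourage_diagonal A : ent A -> diagonal `<=` A.
Proof.
move=> [r /= /andP[r0 re] rA] [p q] /diagonalP <- {q}; apply: rA.
have rend : mdist (chain_end (repr p)) (chain_end (repr p)) < e%:num.
  by rewrite mdistxx.
have [t tE] := chain_rcons_ex rend.
exists (repr p), t, (chain_end (repr p)); split=> //; last by rewrite mdistxx.
rewrite chain_mk_repr; congr (_, _); rewrite -{1}[p]chain_mk_repr.
apply/chain_mkP; rewrite tE -cats1 -[X in chain_homotopic _ _ X]cats0.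
apply: chain_homotopic_catl; first exact: valP.
by apply: rst_sym; exact: chain_homotopic_stutter.
Qed.

Lemma cover_entourage_inv A : ent A -> ent A^-1.
Proof.
move=> [r /= /andP[r0 re] rA]; exists r; first by rewrite /= r0.
move=> _ [s [t [y [-> tE sy]]]] /=; apply: rA.
have tend : chain_end t = y by rewrite /chain_end tE last_rcons.
have ys : mdist (chain_end t) (chain_end s) < e%:num.
  by rewrite tend metric_sym (lt_le_trans sy).
have [u uE] := chain_rcons_ex ys; exists t, u, (chain_end s).
split=> //; last by rewrite tend metric_sym.
congr (_, _); apply/chain_mkP; rewrite uE tE -!cats1 -catA /= -[X in chain_homotopic _ _ X]cats0.
apply: chain_homotopic_catl; first exact: valP.
by apply: rst_sym; apply: chain_homotopic_detour; exact: lt_le_trans re.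
Qed.

Lemma cover_entourage_split A : ent A -> exists2 B, ent B & B \; B `<=` A.
Proof.
move=> [r /= /andP[r0 re] rA]; exists (cover_ball (r / 2)).
  exists (r / 2) => //=; rewrite divr_gt0 //= (le_trans _ re) //.
  by rewrite ler_pdivrMr // ler_peMr ?ler1n // ltW.
move=> [p z] [q /= [s [t [y [[-> qE] tE sy]]]]].
move=> [s' [t' [w [[qE' ->] tE' sw]]]]; apply: rA.
have rr : r / 2 <= r by rewrite ler_pdivrMr // ler_peMr ?ler1n // ltW.
have hst : chain_homotopic e%:num pt (val s') (val t).
  by apply/chain_mkP; rewrite -qE' qE.
have es' : chain_end s' = y.
  by rewrite /chain_end (chain_homotopic_last hst) tE last_rcons.
have yw : mdist y w < r / 2 by rewrite -es'.
have dw : mdist (chain_end s) w < r.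
  by rewrite [r]splitr (le_lt_trans (metric_triangle _ y _)) // ltrD.
have [u uE] := chain_rcons_ex (lt_le_trans dw re).
exists s, u, w; split=> //; congr (_, _); apply/chain_mkP; rewrite tE' uE.
have ltre (a : R) : a < r / 2 -> a < e%:num.
  by move=> h; rewrite (lt_le_trans h) // (le_trans rr).
apply: (@rst_trans _ _ _ (rcons (val t) w)).
  rewrite -!cats1; apply: chain_homotopic_catr => //=.
  by rewrite andbT; apply: ltre.
rewrite tE -!cats1 -catA /=; apply: chain_homotopic_catl; first exact: valP.
by apply: chain_homotopic_shortcut; [exact: ltre|exact: ltre|exact: lt_le_trans re].
Qed.

HB.instance Definition _ := isUniform.Build (chain_cover pt e)
  cover_entourage_filter cover_entourage_diagonal cover_entourage_inv
  cover_entourage_split.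

End CoverUniform.

(* X_eps with its lifted length metric. It is only declared as a pseudometric *)
(* space: its finiteness and positivity need X to be a length space.          *)
Definition Xeps {R : realType} {X : metricType R} (pt : X) (e : {posnum R}) :
  Type := chain_cover pt e.

Section LiftedMetric.
Context {R : realType} {X : metricType R} (pt : X) (e : {posnum R}).

HB.instance Definition _ := Choice.on (Xeps pt e).

Definition Xeps_ball (p : Xeps pt e) (r : R) : set (Xeps pt e) :=
  [set q | (lifted_dist (@endpoint R X pt e) p q < r%:E)%E].

Lemma Xeps_ball_center p (r : R) : 0 < r -> Xeps_ball p r p.
Proof. by move=> r0; apply: (le_lt_trans (lifted_distxx _ _)); rewrite lte_fin. Qed.

Lemma Xeps_ball_sym p q (r : R) : Xeps_ball p r q -> Xeps_ball q r p.
Proof. exact: lifted_dist_sym_lt. Qed.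

Lemma Xeps_ball_triangle p q z (r1 r2 : R) :
  Xeps_ball p r1 q -> Xeps_ball q r2 z -> Xeps_ball p (r1 + r2) z.
Proof. exact: lifted_dist_triangle_lt. Qed.

HB.instance Definition _ :=
  hasNbhs.Build (Xeps pt e) (nbhs_ (entourage_ Xeps_ball)).
HB.instance Definition _ := Nbhs_isPseudoMetric.Build R (Xeps pt e)
  erefl Xeps_ball_center Xeps_ball_sym Xeps_ball_triangle erefl.

End LiftedMetric.

Section UniformUniversalCover.
Context {R : realType} {X : metricType R} (pt : X).

Lemma chain_widen_subproof (d e : {posnum R}) (h : d%:num < e%:num) (s : chain pt d) :
  path (close e%:num) pt (val s).
Proof. by apply: sub_path (valP s); exact/closeW/ltW. Qed.

Definition chain_widen (d e : {posnum R}) (h : d%:num < e%:num) (s : chain pt d) :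
  chain pt e :=
  exist (fun t => is_true (path (close e%:num) pt t)) (val s)
    (chain_widen_subproof h s).

Definition bonding (d e : {posnum R}) (h : d%:num < e%:num) (p : Xeps pt d) :
  Xeps pt e := chain_mk (chain_widen h (repr p)).

(* The ascription selects the lifted metric uniformity of Xeps, as opposed to *)
(* the one of the convertible type chain_cover.                               *)
Definition Xeps_uniform (e : {posnum R}) : uniformType := Xeps pt e.

Definition inverse_limit : set (prod_topology Xeps_uniform) :=
  [set x | forall (d e : {posnum R}) (h : d%:num < e%:num), bonding h (x d) = x e].

Definition Xtilde : uniformType := set_type inverse_limit.

Definition coord (e : {posnum R}) (x : Xtilde) : Xeps pt e := val x e.

End UniformUniversalCover.

Section Concatenation.
Context {R : realType} {X : metricType R} (pt : X).
Implicit Types (d e : {posnum R}).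

Lemma bonding_mk d e (h : d%:num < e%:num) (s : chain pt d) :
  bonding h (chain_mk s) = chain_mk (chain_widen h s).
Proof.
apply/chain_mkP; apply: (chain_homotopicW (ltW h)); apply/chain_mkP.
by rewrite chain_mk_repr.
Qed.

Lemma endpoint_bonding d e (h : d%:num < e%:num) (p : Xeps pt d) :
  endpoint (bonding h p) = endpoint p.
Proof. by rewrite /bonding endpointE -[p in RHS]chain_mk_repr endpointE. Qed.

Section Level.
Variable e : {posnum R}.

Definition chain_triv : chain pt e :=
  exist (fun s => is_true (path (close e%:num) pt s)) [::] isT.

(* s ++ t is a chain when s is a loop; the default is used only otherwise.    *)
Definition chain_cat (s t : chain pt e) : chain pt e :=
  insubd t (val s ++ val t).

Lemma val_chain_cat (s t : chain pt e) : chain_end s = pt ->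
  val (chain_cat s t) = val s ++ val t.
Proof.
by move=> sE; rewrite val_insubd cat_path -/(chain_end s) sE (valP s) (valP t).
Qed.

Definition cover_cat (p q : Xeps pt e) : Xeps pt e :=
  chain_mk (chain_cat (repr p) (repr q)).

Lemma cover_cat_mk (s t : chain pt e) : chain_end s = pt ->
  cover_cat (chain_mk s) (chain_mk t) = chain_mk (chain_cat s t).
Proof.
move=> sE; have rE : chain_end (repr (chain_mk s)) = pt.
  exact: etrans (endpointE s) sE.
apply/chain_mkP; rewrite !val_chain_cat //.
apply: (@rst_trans _ _ _ (val s ++ val (repr (chain_mk t)))).
  apply: chain_homotopic_catr; last by apply/chain_mkP; rewrite chain_mk_repr.
  by rewrite -/(chain_end _) rE; exact: valP.
apply: chain_homotopic_catl; first exact: valP.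
by rewrite -/(chain_end s) sE; apply/chain_mkP; rewrite chain_mk_repr.
Qed.

Lemma chain_inv_subproof (s : chain pt e) : chain_end s = pt ->
  path (close e%:num) pt (chain_rev pt (val s)).
Proof.
move=> sE; have : path (close e%:num) (chain_end s) (chain_rev pt (val s)).
  by rewrite path_chain_rev; exact: valP.
by rewrite sE.
Qed.

Definition chain_inv (s : chain pt e) : chain pt e :=
  insubd s (chain_rev pt (val s)).

Lemma val_chain_inv (s : chain pt e) : chain_end s = pt ->
  val (chain_inv s) = chain_rev pt (val s).
Proof. by move=> sE; rewrite val_insubd chain_inv_subproof. Qed.

Definition cover_inv (p : Xeps pt e) : Xeps pt e := chain_mk (chain_inv (repr p)).

Lemma endpoint_cat (p q : Xeps pt e) : endpoint p = pt ->
  endpoint (cover_cat p q) = endpoint q.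
Proof.
move=> pE; rewrite endpointE /chain_end val_chain_cat //.
by rewrite last_cat -/(chain_end _) [chain_end (repr p)]pE.
Qed.

Lemma endpoint_inv (p : Xeps pt e) : endpoint p = pt ->
  endpoint (cover_inv p) = pt.
Proof.
move=> pE; rewrite endpointE /chain_end val_chain_inv //.
rewrite -[RHS](last_rev_belast pt (val (repr p))).
by rewrite -/(chain_end _) [chain_end (repr p)]pE.
Qed.

Lemma cover_catA (p q z : Xeps pt e) : endpoint p = pt -> endpoint q = pt ->
  cover_cat p (cover_cat q z) = cover_cat (cover_cat p q) z.
Proof.
move=> pE qE; rewrite -[p]chain_mk_repr -[q]chain_mk_repr -[z]chain_mk_repr.
move: pE qE; rewrite /endpoint => pE qE.
have cE : chain_end (chain_cat (repr p) (repr q)) = pt.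
  rewrite /chain_end val_chain_cat // last_cat -/(chain_end _) pE.
  exact: qE.
rewrite !cover_cat_mk //; apply/chain_mkP; rewrite !val_chain_cat // catA.
exact: rst_refl.
Qed.

Lemma cover_cat1 (p : Xeps pt e) : cover_cat (chain_mk chain_triv) p = p.
Proof.
rewrite -[p]chain_mk_repr cover_cat_mk //; apply/chain_mkP.
by rewrite val_chain_cat //; exact: rst_refl.
Qed.

Lemma cover_cat1r (p : Xeps pt e) : endpoint p = pt ->
  cover_cat p (chain_mk chain_triv) = p.
Proof.
rewrite -[p]chain_mk_repr endpointE => pE; rewrite cover_cat_mk //.
by apply/chain_mkP; rewrite val_chain_cat // cats0; exact: rst_refl.
Qed.

Lemma cover_catV (p : Xeps pt e) : endpoint p = pt ->
  cover_cat p (cover_inv p) = chain_mk chain_triv.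
Proof.
move=> pE; rewrite -{1}[p]chain_mk_repr cover_cat_mk //; apply/chain_mkP.
rewrite val_chain_cat // val_chain_inv //.
by apply: chain_homotopic_revr; exact: valP.
Qed.

Lemma cover_catVl (p : Xeps pt e) : endpoint p = pt ->
  cover_cat (cover_inv p) p = chain_mk chain_triv.
Proof.
move=> pE; have iE : chain_end (chain_inv (repr p)) = pt.
  by rewrite -endpointE; exact: endpoint_inv.
rewrite -{2}[p]chain_mk_repr cover_cat_mk //; apply/chain_mkP.
rewrite val_chain_cat // val_chain_inv //.
have := chain_homotopic_revl (valP (repr p)).
by rewrite -/(chain_end _) [chain_end (repr p)]pE.
Qed.

End Level.

Lemma bonding_cat d e (h : d%:num < e%:num) (p q : Xeps pt d) :
  endpoint p = pt -> bonding h (cover_cat p q) = cover_cat (bonding h p) (bonding h q).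
Proof.
move=> pE; rewrite bonding_mk cover_cat_mk //.
by apply/chain_mkP; rewrite /= !val_chain_cat //; exact: rst_refl.
Qed.

Lemma bonding_triv d e (h : d%:num < e%:num) :
  bonding h (chain_mk (chain_triv d)) = chain_mk (chain_triv e).
Proof. by rewrite bonding_mk; apply/chain_mkP; exact: rst_refl. Qed.

Lemma bonding_inv d e (h : d%:num < e%:num) (p : Xeps pt d) :
  endpoint p = pt -> bonding h (cover_inv p) = cover_inv (bonding h p).
Proof.
move=> pE; have bE : endpoint (bonding h p) = pt by rewrite endpoint_bonding.
have iE := endpoint_inv pE.
rewrite -[LHS]cover_cat1r ?endpoint_bonding //.
rewrite -(cover_catV bE) cover_catA ?endpoint_bonding //.
by rewrite -bonding_cat // cover_catVl // bonding_triv cover_cat1.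
Qed.

End Concatenation.

Section UniformFundamentalGroup.
Context {R : realType} {X : metricType R} (pt : X).

Lemma coordP (x : Xtilde pt) : inverse_limit (val x).
Proof. exact: set_valP. Qed.

Lemma Xtilde_ext (x y : Xtilde pt) : (forall e, coord e x = coord e y) -> x = y.
Proof. by move=> xy; apply: val_inj; apply: functional_extensionality_dep. Qed.

Definition Xtilde_mk (x : prod_topology (Xeps_uniform pt)) (h : inverse_limit x) :
  Xtilde pt := exist _ x (mem_set h).

(* The endpoint does not depend on the index (endpoint_bonding).              *)
Definition phi (x : Xtilde pt) : X := endpoint (coord 1%:pos x).

Lemma base_subproof :
  inverse_limit ((fun e => chain_mk (chain_triv pt e)) : prod_topology (Xeps_uniform pt)).
Proof. by move=> d e h; exact: bonding_triv. Qed.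

Definition base : Xtilde pt := Xtilde_mk base_subproof.

Definition delta_set : set (Xtilde pt) :=
  [set g | forall e, endpoint (coord e g) = pt].

Definition delta : Type := set_type delta_set.
HB.instance Definition _ := Choice.on delta.

Definition delta_val (g : delta) : Xtilde pt := val g.

Lemma delta_valP (g : delta) e : endpoint (coord e (delta_val g)) = pt.
Proof. exact: (set_valP g). Qed.

Lemma act_subproof (g : delta) (x : Xtilde pt) :
  inverse_limit ((fun e => cover_cat (coord e (delta_val g)) (coord e x))
    : prod_topology (Xeps_uniform pt)).
Proof.
by move=> d e h; rewrite bonding_cat ?delta_valP // !coordP.
Qed.

Definition act (g : delta) (x : Xtilde pt) : Xtilde pt :=
  Xtilde_mk (act_subproof g x).

Lemma coord_act e g x :
  coord e (act g x) = cover_cat (coord e (delta_val g)) (coord e x).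
Proof. by []. Qed.

Definition delta_mk (x : Xtilde pt) (h : delta_set x) : delta :=
  exist _ x (mem_set h).

Lemma delta_one_subproof : delta_set base.
Proof. by move=> e; rewrite endpointE. Qed.

Definition delta_one : delta := delta_mk delta_one_subproof.

Lemma delta_mul_subproof (g h : delta) : delta_set (act g (delta_val h)).
Proof. by move=> e; rewrite coord_act endpoint_cat ?delta_valP. Qed.

Definition delta_mul (g h : delta) : delta := delta_mk (delta_mul_subproof g h).

Lemma delta_inv_limit (g : delta) :
  inverse_limit ((fun e => cover_inv (coord e (delta_val g)))
    : prod_topology (Xeps_uniform pt)).
Proof. by move=> d e h; rewrite bonding_inv ?delta_valP // coordP. Qed.

Lemma delta_inv_subproof (g : delta) : delta_set (Xtilde_mk (delta_inv_limit g)).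
Proof. by move=> e; apply: endpoint_inv; rewrite delta_valP. Qed.

Definition delta_inv (g : delta) : delta := delta_mk (delta_inv_subproof g).

Lemma delta_ext (g h : delta) :
  (forall e, coord e (delta_val g) = coord e (delta_val h)) -> g = h.
Proof. by move=> gh; apply: val_inj; exact: Xtilde_ext. Qed.

Lemma delta_mulA : associative delta_mul.
Proof. by move=> g h k; apply: delta_ext => e; apply: cover_catA; exact: delta_valP. Qed.

Lemma delta_mul1 : left_id delta_one delta_mul.
Proof. by move=> g; apply: delta_ext => e; exact: cover_cat1. Qed.

Lemma delta_mul1r : right_id delta_one delta_mul.
Proof. by move=> g; apply: delta_ext => e; apply: cover_cat1r; exact: delta_valP. Qed.

Lemma delta_mulV : left_inverse delta_one delta_inv delta_mul.
Proof. by move=> g; apply: delta_ext => e; apply: cover_catVl; exact: delta_valP. Qed.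

Lemma delta_mulVr : right_inverse delta_one delta_inv delta_mul.
Proof. by move=> g; apply: delta_ext => e; apply: cover_catV; exact: delta_valP. Qed.

HB.instance Definition _ := isGroup.Build delta
  delta_mulA delta_mul1 delta_mul1r delta_mulV delta_mulVr.

Lemma act1 (x : Xtilde pt) : act 1%g x = x.
Proof. by apply: Xtilde_ext => e; exact: cover_cat1. Qed.

Lemma actM (g h : delta) (x : Xtilde pt) : act (g * h)%g x = act g (act h x).
Proof.
by apply: Xtilde_ext => e; apply/esym/cover_catA; exact: delta_valP.
Qed.

End UniformFundamentalGroup.

Section FundamentalGroup.
Context {R : realType} {X : metricType R} (pt : X).

Definition loops : set (R -> X) :=
  [set c | [/\ path_on 0 1 c, c 0 = pt & c 1 = pt]].

Definition pi1_class (c : R -> X) : set (R -> X) :=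
  [set c' | loops c' /\ path_homotopic_in setT 0 1 c c'].

Definition pi1 : set (set (R -> X)) := [set pi1_class c | c in loops].

Definition mu1 : set (set (R -> X)) :=
  [set A | pi1 A /\ exists2 c, A c & rectifiable 0 1 c].

(* The default value 1 of xget is not used on pi1 when X is a length space:   *)
(* there is then exactly one such g.                                          *)
Definition lambda (A : set (R -> X)) : delta pt :=
  xget 1%g [set g | exists (c : R -> X) (cL : R -> Xtilde pt),
    [/\ A c, is_lift (@phi R X pt) 0 1 c cL, cL 0 = base pt &
        act g (base pt) = cL 1]].

Definition mu : set (delta pt) := lambda @` mu1.

End FundamentalGroup.
Arguments mu {R X} pt.

Section MetricCore.
Context {R : realType} {X : metricType R} (pt : X).

Definition dXt : Xtilde pt -> Xtilde pt -> \bar R := lifted_dist (@phi R X pt).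

Definition metric_core : set (Xtilde pt) :=
  [set x | (dXt x (base pt) < +oo)%E].

Record core_metric : Prop := CoreMetric {
  core_fin : forall x y, metric_core x -> metric_core y -> dXt x y \is a fin_num;
  core_xx : forall x, metric_core x -> dXt x x = 0%E;
  core_positivity : forall x y, metric_core x -> metric_core y ->
    dXt x y = 0%E -> x = y;
  core_sym : forall x y, metric_core x -> metric_core y -> dXt x y = dXt y x;
  core_triangle : forall y x z,
    metric_core x -> metric_core y -> metric_core z ->
    (dXt x z <= dXt x y + dXt y z)%E }.

Definition core_space (h : core_metric) : Type := set_type metric_core.

Context (h : core_metric).
HB.instance Definition _ := SubChoice.on (core_space h).

Definition core_val (x : core_space h) : Xtilde pt := val x.

Definition core_mdist (x y : core_space h) : R := fine (dXt (core_val x) (core_val y)).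

Lemma core_valP (x : core_space h) : metric_core (core_val x).
Proof. exact: set_valP. Qed.

Lemma core_mdistE x y : (core_mdist x y)%:E = dXt (core_val x) (core_val y).
Proof. by rewrite /core_mdist fineK //; apply: (core_fin h); exact: core_valP. Qed.

Lemma core_mdistxx x : core_mdist x x = 0.
Proof. by rewrite /core_mdist (core_xx h) //; exact: core_valP. Qed.

Lemma core_mdist_positivity x y : core_mdist x y = 0 -> x = y.
Proof.
move=> xy; apply: val_inj; apply: (core_positivity h); try exact: core_valP.
by rewrite -core_mdistE xy.
Qed.

Lemma core_mdist_sym x y : core_mdist x y = core_mdist y x.
Proof. by rewrite /core_mdist (core_sym h) //; exact: core_valP. Qed.

Lemma core_mdist_triangle y x z :
  core_mdist x z <= core_mdist x y + core_mdist y z.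
Proof.
by rewrite -lee_fin EFinD !core_mdistE; apply: (core_triangle h); exact: core_valP.
Qed.

(* The uniformity is the one of the metric, not the one induced by Xtilde.    *)
HB.instance Definition _ := isMetric.Build R (core_space h)
  core_mdistxx core_mdist_positivity core_mdist_sym core_mdist_triangle.

Definition core_phi (x : core_space h) : X := phi (core_val x).

Lemma base_in_core : metric_core (base pt).
Proof. by apply: (le_lt_trans (lifted_distxx _ _)); exact: ltry. Qed.

Definition core_base : core_space h := exist _ (base pt) (mem_set base_in_core).

Definition core_stabilizer : set (delta pt) :=
  [set g | act g @` metric_core = metric_core].

(* The default x is not used when g stabilizes the core.                      *)
Definition core_act (g : delta pt) (x : core_space h) : core_space h :=
  insubd x (act g (core_val x)).

Definition mu_orbit (x : core_space h) : set (core_space h) :=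
  [set core_act g x | g in mu pt].

Definition mu_quotient : set (set (core_space h)) := range mu_orbit.

Definition mu_quotient_dist (x y : core_space h) : R :=
  inf [set mdist (core_act g x) y | g in mu pt].

End MetricCore.
Arguments metric_core {R X} pt.
Arguments core_stabilizer {R X} pt.
Arguments mu_quotient {R X pt} h.

Section URL.
Context {R : realType}.

Definition one_lipschitz {Y Z : metricType R} (f : Y -> Z) : Prop :=
  forall x y, mdist (f x) (f y) <= mdist x y.

Definition complete_space (U : uniformType) : Prop :=
  forall F : set_system U, ProperFilter F -> cauchy F -> exists x : U, F --> x.

Definition URL_map {Z X : metricType R} (f : Z -> X) : Prop :=
  (forall (a b : R) (c : R -> Z), rectifiable a b c ->
     path_length a b c = path_length a b (f \o c)) /\
  (forall (a b : R) (c : R -> X) (q : Z), rectifiable a b c -> f q = c a ->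
     exists cL : R -> Z,
       [/\ is_lift f a b c cL, cL a = q, rectifiable a b cL &
           forall cL' : R -> Z, is_lift f a b c cL' -> cL' a = q ->
             {in `[a, b], cL' =1 cL}]).

Definition weakly_normal {T : topologicalType} (a b : R) (c : R -> T) : Prop :=
  ~ exists u v : R, [/\ a <= u, u < v, v <= b, c u = c v &
      path_homotopic_in (c @` `[u, v]) u v c (cst (c u))].

Definition arclength_param {X : metricType R} (a b : R) (c : R -> X) : Prop :=
  forall u v, a <= u -> u <= v -> v <= b -> path_length u v c = (v - u)%:E.

Definition rho_path {X : metricType R} (a b : R) (c : R -> X) : Prop :=
  [/\ rectifiable a b c, weakly_normal a b c & arclength_param a b c].

Definition rho_loop {X : metricType R} (pt : X) (a b : R) (c : R -> X) : Prop :=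
  [/\ rho_path a b c, c a = pt & c b = pt].

Definition rectangle (a b T : R) : set (R * R) := `[a, b] `*` `[0, T].

(* The library has no metricType on R * R, and its balls there are max-balls. *)
Definition euclidean_dist (p q : R * R) : R :=
  Num.sqrt ((p.1 - q.1) ^+ 2 + (p.2 - q.2) ^+ 2).

Definition lipschitz_homotopy {X : metricType R} (a b T : R) (H : R * R -> X) :
    Prop :=
  [/\ a <= b, 0 < T & forall p q, rectangle a b T p -> rectangle a b T q ->
      mdist (H p) (H q) <= euclidean_dist p q].

Definition is_homotopy_lift {Z X : metricType R} (f : Z -> X) (a b T : R)
    (H : R * R -> X) (HL : R * R -> Z) : Prop :=
  {within rectangle a b T, continuous HL} /\
  forall p, rectangle a b T p -> f (HL p) = H p.

Definition H_L {X : metricType R} (pt : X) (a b : R) (c : R -> X) : Prop :=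
  rho_loop pt a b c /\ exists (T : R) (H : R * R -> X),
    [/\ lipschitz_homotopy a b T H,
        {in `[a, b], forall t, H (t, 0) = c t /\ H (t, T) = pt} &
        {in `[0, T], forall s, H (a, s) = pt /\ H (b, s) = pt}].

(* G a b c means that the rho-loop c : [a, b] -> X belongs to G; the group    *)
(* law of the group of rho-loops plays no role in the condition.              *)
Definition URL_over {Z X : metricType R} (G : R -> R -> (R -> X) -> Prop)
    (f : Z -> X) (z0 : Z) (x0 : X) : Prop :=
  [/\ URL_map f, f z0 = x0 &
      forall (a b : R) (c : R -> X) (cL : R -> Z), G a b c ->
        is_lift f a b c cL -> cL a = z0 -> cL b = z0].

End URL.

(* Main.v *)
(** The level-e covers are handled through one relation: p and q in X_e are
    adjacent when q is p extended by a point within e of its endpoint. Adjacent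
    points with the same endpoint are equal, and if p, q and q, z are adjacent
    while the endpoints of p and z are within e, then p and z are adjacent. By
    connectedness of the segment, two paths that start at adjacent points and
    whose projections stay within e of each other remain adjacent; this single
    fact yields uniqueness of lifts, compatibility of the level lifts with the
    inverse system, homotopy invariance, and [d x y < e -> x, y adjacent].
    A rectifiable path has a continuous arc length, which dominates d along its
    lift: hence lifts of rectifiable paths are continuous for d, and the metric
    core has the path lengths of X. *)
From Stdlib Require Import Relation_Operators.
Require Import Defs.
From mathcomp Require Import lra ring.

Set Implicit Arguments.
Unset Strict Implicit.
Unset Printing Implicit Defensive.

Import Order.TTheory GRing.Theory Num.Theory.

(** * Adjacency *)

(** The obstacle is that three topologies meet. Each [chain_cover] has a combinatorial uniformity,
    and [lifted_dist] takes its infimum over paths continuous for it; the factors of [Xtilde] carry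
    the uniformity of the resulting lifted metric; the core carries that of [dXt]. Adjacency
    translates between them: a short path forces its ends to be adjacent, and in a length space
    adjacent points with close endpoints are joined by a short path, the lift of an almost shortest
    path of [X]. Hence a map from a segment to [Xtilde] is a path exactly when its projection is one
    and it is locally adjacent at every level. The restricted transitivity is the filling of a
    triangle with sides below e by a single chain move; it takes the place of evenly covered
    neighbourhoods. On the side of the group, [delta] acts simply transitively on the fibres of
    [phi] and preserves [dXt], so membership in [mu] and stabilizing the core are both decided by
    the position of [act g (base pt)]. *)

Section SegmentInduction.
Context {R : realType}.

(** Local constancy makes the traces of [P] and of its complement on the segment relatively open, so
    connectedness applies. The equivalence in the hypothesis serves both openness and closedness. *)
Lemma segment_induction (a b : R) (P : R -> Prop) :
  (forall t, t \in `[a, b] ->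
     \forall t' \near within `[a, b]%classic (nbhs t), P t <-> P t') ->
  P a -> {in `[a, b], forall t, P t}.
Proof.
move=> loc Pa t tab.
have ab : a <= b by move: tab; rewrite in_itv /= => /andP[]; exact: le_trans.
(* [U Q] collects the points near which [Q] holds within the segment: an open subset of the line
   with the same trace as [Q] when [Q] is locally constant. *)
pose U (Q : set R) : set R := fun x : R => nbhs x (fun x' : R => x' \in `[a, b] -> Q x').
have oU Q : open (U Q).
  rewrite openE => x; rewrite /U /interior /= => Ux.
  exact: (nbhs_interior Ux).
have UP Q : (forall t, t \in `[a, b] ->
     \forall t' \near within `[a, b]%classic (nbhs t), Q t <-> Q t') ->
    `[a, b]%classic `&` Q = `[a, b]%classic `&` U Q.
  move=> locQ; apply/seteqP; split => x [xab Qx]; split => //.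
    have h : nbhs x (fun x' => x' \in `[a, b] -> (Q x <-> Q x')) := locQ x xab.
    by apply: (@filterS _ (nbhs x) _ _ _ _ h) => x' h1 /h1 [h2 _]; exact: h2.
  by have /nbhs_singleton := Qx; exact.
have locN x : x \in `[a, b] ->
     \forall t' \near within `[a, b]%classic (nbhs x), (~` P) x <-> (~` P) t'.
  by move=> /loc; apply: filterS => x' [h1 h2]; split=> h p; apply: h; [exact: h2|exact: h1].
have nUN x : x \in `[a, b] -> ~ U (~` P) x -> P x.
  move=> xab nU; apply: contrapT => nP; apply: nU.
  by have [] : (`[a, b]%classic `&` U (~` P)) x by rewrite -(UP (~` P)).
have UN x : x \in `[a, b] -> P x -> ~ U (~` P) x.
  move=> xab Px Ux.
  by have [] : (`[a, b]%classic `&` (~` P)) x by rewrite (UP (~` P)).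
suff : `[a, b]%classic `&` P = `[a, b]%classic.
  by move/seteqP => [_ /(_ t tab) []].
apply: (@segment_connected R a b).
- by exists a; split => //=; rewrite in_itv /= lexx.
- by exists (U P) => //; rewrite UP.
- exists (~` U (~` P)); first exact: open_closedC.
  by apply/seteqP; split => x [xab h]; split => //; [exact: UN|exact: nUN].
Qed.

End SegmentInduction.

Section Adjacency.
Context {R : realType} {X : metricType R}.

(** Abstracted from the covers because paths are compared in two settings: at each level over
    [endpoint], and on the inverse limit over [phi]. *)
Record adjacency (Z : Type) (ep : Z -> X) (e : R) (adj : Z -> Z -> Prop) : Prop :=
  Adjacency {
    adjacency_refl : forall p, adj p p;
    adjacency_sym : forall p q, adj p q -> adj q p;
    adjacency_mdist : forall p q, adj p q -> mdist (ep p) (ep q) < e;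
    adjacency_trans : forall p q z, adj p q -> adj q z ->
      mdist (ep p) (ep z) < e -> adj p z }.

(** The part of continuity that the projection does not see. *)
Definition adj_path (Z : Type) (adj : Z -> Z -> Prop) (a b : R) (c : R -> Z) :=
  {in `[a, b], forall t,
    \forall t' \near within `[a, b]%classic (nbhs t), adj (c t) (c t')}.

Lemma path_on_mdist (a b : R) (c : R -> X) : path_on a b c <-> a <= b /\
  {in `[a, b], forall t, forall e, 0 < e ->
    \forall t' \near within `[a, b]%classic (nbhs t), mdist (c t) (c t') < e}.
Proof.
split=> -[ab h]; split=> //.
  move=> t tab e e0; move/subspace_continuousP : h => /(_ t tab).
  by move=> /metricType_numDomainType.cvgrPdist_lt /(_ e e0).
apply/subspace_continuousP => t tab.
by apply/metricType_numDomainType.cvgrPdist_lt => e e0; exact: h.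
Qed.

(** Adjacency of [c1 t] and [c2 t] is locally constant in t: the two points move to time t' one
    after the other, and the mixed pair in between still projects within e. *)
Lemma adj_path_close (Z : Type) (ep : Z -> X) (e : R) adj (a b : R)
    (c1 c2 : R -> Z) :
  adjacency ep e adj -> path_on a b (ep \o c1) -> path_on a b (ep \o c2) ->
  adj_path adj a b c1 -> adj_path adj a b c2 ->
  {in `[a, b], forall t, mdist (ep (c1 t)) (ep (c2 t)) < e} ->
  adj (c1 a) (c2 a) -> {in `[a, b], forall t, adj (c1 t) (c2 t)}.
Proof.
move=> [rfl sym dst trs] /path_on_mdist[ab h1] /path_on_mdist[_ h2] l1 l2 d12.
apply: segment_induction => t tab.
(* The slack left at time t: moves shorter than this keep the mixed pairs within e. *)
have d0 : 0 < e - mdist (ep (c1 t)) (ep (c2 t)) by rewrite subr_gt0 d12.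
near=> t'.
have tab' : t' \in `[a, b] by near: t'; apply: withinT.
have dc1 : mdist (ep (c1 t)) (ep (c1 t')) < e - mdist (ep (c1 t)) (ep (c2 t)).
  by near: t'; exact: h1.
have dc2 : mdist (ep (c2 t)) (ep (c2 t')) < e - mdist (ep (c1 t)) (ep (c2 t)).
  by near: t'; exact: h2.
have a1 : adj (c1 t) (c1 t') by near: t'; exact: l1.
have a2 : adj (c2 t) (c2 t') by near: t'; exact: l2.
split => adj12.
- apply: (trs _ (c2 t)) => //; last exact: d12.
  apply: (trs _ (c1 t)) => //; first exact: sym.
  rewrite (le_lt_trans (metric_triangle _ (ep (c1 t)) _)) //.
  by rewrite metric_sym -ltrBrDr.
- apply: (trs _ (c2 t')) => //; last exact: d12.
    apply: (trs _ (c1 t')) => //.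
    rewrite (le_lt_trans (metric_triangle _ (ep (c2 t)) _)) //.
    by rewrite addrC -ltrBrDr.
  exact: sym.
Unshelve. all: by end_near. Qed.

End Adjacency.

Section LevelAdjacency.
Context {R : realType} {X : metricType R} {pt : X} {e : {posnum R}}.
Implicit Types p q z : chain_cover pt e.

Definition adj p q : Prop := cover_ball e%:num (p, q).

Lemma endpoint_rcons (s t : chain pt e) y : val t = rcons (val s) y ->
  endpoint (chain_mk t) = y.
Proof. by move=> tE; rewrite endpointE /chain_end tE last_rcons. Qed.

(** Smaller radii only restrict the endpoints, so the single relation [adj] and the distance of [X]
    determine the uniformity of a level cover. *)
Lemma cover_ballE (r : R) p q : r <= e%:num ->
  cover_ball r (p, q) <-> adj p q /\ mdist (endpoint p) (endpoint q) < r.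
Proof.
move=> re; split=> [[s [t [y [[-> ->] tE sy]]]]|[[s [t [y [[-> ->] tE sy]]]] d]].
  split; first by exists s, t, y; split=> //; exact: lt_le_trans re.
  by rewrite (endpoint_rcons tE) endpointE.
by exists s, t, y; split=> //; move: d; rewrite (endpoint_rcons tE) endpointE.
Qed.

(** Symmetry removes the detour to the added point and back; transitivity erases the middle vertex
    of a triangle whose three sides are below e. *)
Lemma adj_adjacency : adjacency (@endpoint R X pt e) e%:num adj.
Proof.
have E : cover_entourage (@cover_ball R X pt e e%:num).
  by exists e%:num => //=; rewrite lexx andbT.
split.
- by move=> p; apply: (cover_entourage_diagonal E); exact/diagonalP.
- move=> p q [s [t [y [[-> ->] tE sy]]]].
  have tend : chain_end t = y by rewrite /chain_end tE last_rcons.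
  have ys : mdist (chain_end t) (chain_end s) < e%:num.
    by rewrite tend metric_sym.
  have [u uE] := chain_rcons_ex ys; exists t, u, (chain_end s); split=> //.
  congr (_, _); apply/chain_mkP; rewrite uE tE -!cats1 -catA /=.
  rewrite -[X in chain_homotopic _ _ X]cats0.
  apply: chain_homotopic_catl; first exact: valP.
  by apply: rst_sym; apply: chain_homotopic_detour.
- by move=> p q /cover_ballE -/(_ (lexx _)) [].
move=> p q z [s [t [y [[-> ->] tE sy]]]] [s' [t' [w [[qE ->] tE' sw]]]].
rewrite endpointE (endpoint_rcons tE') => dw.
have hst : chain_homotopic e%:num pt (val s') (val t) by apply/chain_mkP.
have es' : chain_end s' = y.
  by rewrite /chain_end (chain_homotopic_last hst) tE last_rcons.
rewrite es' in sw.
have [u uE] := chain_rcons_ex dw.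
exists s, u, w; split=> //; congr (_, _); apply/chain_mkP; rewrite tE' uE.
apply: (@rst_trans _ _ _ (rcons (val t) w)).
  by rewrite -!cats1; apply: chain_homotopic_catr => //=; rewrite andbT -/(chain_end _) es'.
rewrite tE -!cats1 -catA /=; apply: chain_homotopic_catl; first exact: valP.
exact: chain_homotopic_shortcut.
Qed.

(** Repeating the last point of a chain is a homotopy. Together with transitivity this makes the
    endpoint map injective on the points adjacent to a given one. *)
Lemma adj_eq p q : adj p q -> endpoint p = endpoint q -> p = q.
Proof.
move=> [s [t [y [[-> ->] tE sy]]]]; rewrite (endpoint_rcons tE) endpointE => sE.
apply/chain_mkP; rewrite tE -cats1 -[X in chain_homotopic _ _ X]cats0.
apply: chain_homotopic_catl; first exact: valP.
rewrite -/(chain_end s) sE; apply: rst_sym; exact: chain_homotopic_stutter.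
Qed.

Lemma adj_extend p y : mdist (endpoint p) y < e%:num ->
  exists2 q, adj p q & endpoint q = y.
Proof.
rewrite -[p]chain_mk_repr endpointE => py; have [t tE] := chain_rcons_ex py.
exists (chain_mk t); last exact: endpoint_rcons tE.
by exists (repr p), t, y.
Qed.

End LevelAdjacency.

(** * Length of paths *)

Section PathLength.
Context {R : realType} {T : metricType R}.
Implicit Types (a b e : R) (c : R -> T) (s : seq R).

Lemma polygonal_length_cat c a s1 s2 : polygonal_length c a (s1 ++ s2) =
  polygonal_length c a s1 + polygonal_length c (last a s1) s2.
Proof.
elim: s1 a => [|x s IH] a; first by rewrite polygonal_length_nil add0r.
by rewrite /= !polygonal_length_cons IH addrA.
Qed.

Lemma path_length_ge_polygonal a b c s : itv_partition a b s ->
  ((polygonal_length c a s)%:E <= path_length a b c)%E.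
Proof. by move=> sp; apply: ereal_sup_ubound; exists s. Qed.

Lemma path_length_ge_mdist a b c : a <= b ->
  ((mdist (c a) (c b))%:E <= path_length a b c)%E.
Proof.
rewrite le_eqVlt => /predU1P[->|ab].
  rewrite mdistxx -(polygonal_length_nil c b).
  by apply: path_length_ge_polygonal; split.
have sp : itv_partition a b [:: b] by split; rewrite /= ?ab.
have := path_length_ge_polygonal c sp.
by rewrite polygonal_length_cons polygonal_length_nil addr0.
Qed.

Lemma path_length_ge0 a b c : a <= b -> (0 <= path_length a b c)%E.
Proof.
by move=> /(path_length_ge_mdist c); apply: le_trans; rewrite lee_fin mdist_ge0.
Qed.

Lemma path_length_superadd a b e c : a <= b -> b <= e ->
  (path_length a b c + path_length b e c <= path_length a e c)%E.
Proof.
move=> ab be.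
have h s1 : itv_partition a b s1 ->
    ((polygonal_length c a s1)%:E + path_length b e c <= path_length a e c)%E.
  move=> p1; rewrite addeC -leeBrDr //; apply: ge_ereal_sup => _ [s2 p2 <-].
  rewrite leeBrDr // -EFinD addrC.
  have <- : polygonal_length c a (s1 ++ s2) =
      polygonal_length c a s1 + polygonal_length c b s2.
    by rewrite polygonal_length_cat; case: p1 => _ /eqP ->.
  exact/path_length_ge_polygonal/(itv_partition_cat p1 p2).
(* Subtraction needs a finite value; if the second length is infinite, one partition of the first
   segment already gives the bound. *)
have := path_length_ge0 c be; case E : (path_length b e c) => [l| |] // _.
  rewrite -leeBrDr //; apply: ge_ereal_sup => _ [s1 p1 <-].
  by rewrite leeBrDr // -E; exact: h.
have [s1 p1] : exists s1, itv_partition a b s1.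
  move: ab; rewrite le_eqVlt => /predU1P[->|ab]; first by exists [::]; split.
  by exists [:: b]; split; rewrite /= ?ab.
have := h s1 p1; rewrite E addey // leye_eq => /eqP ->.
by rewrite leey.
Qed.

Lemma path_length_sub a b u v c : a <= u -> u <= v -> v <= b ->
  (path_length u v c <= path_length a b c)%E.
Proof.
move=> au uv vb.
apply: le_trans (path_length_superadd c au (le_trans uv vb)).
apply: le_trans (_ : (path_length u b c <= _)%E); last first.
  by rewrite leeDr // path_length_ge0.
apply: le_trans (path_length_superadd c uv vb).
by rewrite leeDl // path_length_ge0.
Qed.

Lemma path_length_cst a b (x : T) : a <= b -> path_length a b (cst x) = 0%E.
Proof.
move=> ab; apply/eqP; rewrite eq_le path_length_ge0 // andbT.
apply: ge_ereal_sup => _ [s _ <-]; rewrite lee_fin /polygonal_length.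
by rewrite big1 // => p _; rewrite mdistxx.
Qed.

Lemma path_length_eq a b (c c' : R -> T) :
  {in `[a, b], c =1 c'} -> path_length a b c = path_length a b c'.
Proof.
move=> cc'; apply/eqP; rewrite eq_le; apply/andP; split.
  by apply: (path_length_comp_le (f := id)) => // t tab; apply: cc'; rewrite in_itv.
by apply: (path_length_comp_le (f := id)) => // t tab; rewrite cc' // in_itv.
Qed.

(** A comparison principle: superadditivity lets the bound on chords be summed along a partition. It
    is applied with the length of another path and with a multiple of the parameter. *)
Lemma path_length_le_superadd (l : R -> R -> \bar R) a b c : a <= b ->
  (forall t, (0 <= l t t)%E) ->
  (forall x y z, x <= y -> y <= z -> (l x y + l y z <= l x z)%E) ->
  (forall u v : R, a <= u -> u <= v -> v <= b ->
    ((mdist (c u) (c v))%:E <= l u v)%E) ->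
  (path_length a b c <= l a b)%E.
Proof.
move=> _ l0 lD h; apply: ge_ereal_sup => _ [s sp <-].
elim: s a sp h => [|x s IH] a [/= p /eqP e] h.
  by rewrite polygonal_length_nil e l0.
case/andP: p => ax p; have sp : itv_partition x b s by split; rewrite // e.
have xb : x <= b.
  by have /andP[] := itv_partition_bounds sp (mem_head _ _).
rewrite polygonal_length_cons EFinD.
apply: le_trans (lD a x b (ltW ax) xb); apply: leeD.
  by apply: h => //; exact: ltW.
apply: IH => // u v xu; apply: h; exact: le_trans (ltW ax) xu.
Qed.

Lemma path_length_lipschitz a b (k : R) c : a <= b ->
  (forall u v : R, a <= u -> u <= v -> v <= b ->
    mdist (c u) (c v) <= k * (v - u)) ->
  (path_length a b c <= (k * (b - a))%:E)%E.
Proof.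
move=> ab h; apply: (@path_length_le_superadd (fun x y => (k * (y - x))%:E)) => //.
- by move=> t; rewrite subrr mulr0.
- by move=> x y z _ _; rewrite -EFinD lee_fin -mulrDr addrC subrKA.
Qed.

Lemma path_lengthxx a c : path_length a a c = 0%E.
Proof.
apply/eqP; rewrite eq_le path_length_ge0 // andbT.
by apply: ge_ereal_sup => _ [u /itv_partitionxx -> <-]; rewrite polygonal_length_nil.
Qed.

Lemma rectifiable_length a b c u v : rectifiable a b c ->
  a <= u -> u <= v -> v <= b -> exists2 l, 0 <= l & path_length u v c = l%:E.
Proof.
move=> [_ fin] au uv vb; have := path_length_ge0 c uv.
have := path_length_sub c au uv vb.
case: (path_length u v c) => [l| |] //; last by rewrite leye_eq => /eqP h; move: fin; rewrite h ltxx.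
by rewrite lee_fin => _ l0; exists l.
Qed.

(** Right continuity of arc length. A partition that nearly realizes the length on [t, b] loses
    little when its first node moves from t to t', as only one chord changes; so little length
    remains for [t, t']. *)
Lemma path_length_near_right a b c t (d : R) : rectifiable a b c ->
  t \in `[a, b] -> 0 < d ->
  \forall t' \near within `[a, b]%classic (nbhs t),
    t <= t' -> (path_length t t' c < d%:E)%E.
Proof.
move=> rc tab d0; have [[ab /subspace_continuousP cc] _] := rc.
have /andP[at_ tb] : a <= t <= b by move: tab; rewrite in_itv.
move: (tb); rewrite le_eqVlt => /predU1P[teb|tltb].
  near=> t' => tt'.
  have : t' \in `[a, b] by near: t'; apply: withinT.
  rewrite in_itv /= => /andP[_ t'b].
  have <- : t = t' by apply/eqP; rewrite eq_le tt' teb t'b.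
  by rewrite path_lengthxx lte_fin.
have d20 : 0 < d / 2 by rewrite divr_gt0.
have [l0 l00 L0] := rectifiable_length rc at_ tb (lexx b).
have fin0 : path_length t b c \is a fin_num by rewrite L0.
have [_ [s sp <-]] := @ub_ereal_sup_adherent _
  [set (polygonal_length c t s)%:E | s in itv_partition t b] (d / 2) d20 fin0.
rewrite -/(path_length t b c) L0 -EFinB lte_fin.
case: s sp => [[_ /eqP/= tb'] |x s [/= /andP[tx p] /eqP l] lt].
  by move: tltb; rewrite tb' ltxx.
near=> t' => tt'.
have : t' \in `[a, b] by near: t'; apply: withinT.
rewrite in_itv /= => /andP[at' t'b].
have t'x : t' < x.
  by near: t'; apply: cvg_within; exact: lt_nbhsl.
have ctt' : mdist (c t) (c t') < d / 2.
  near: t'; have := cc t tab.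
  by move=> /metricType_numDomainType.cvgrPdist_lt /(_ _ d20).
have sp' : itv_partition t' b (x :: s) by split; rewrite /= ?t'x ?l.
have := path_length_ge_polygonal c sp'; have := path_length_superadd c tt' t'b.
have [l1 _ ->] := rectifiable_length rc at_ tt' t'b.
have [l2 _ ->] := rectifiable_length rc at' t'b (lexx b).
rewrite L0 -EFinD !lee_fin lte_fin => le1 le2.
rewrite !polygonal_length_cons in lt le2.
by have := metric_triangle (c t) (c t') (c x); lra.
Unshelve. all: by end_near. Qed.

(** The mirror argument: the last node t of a partition of [a, t] moves back to t'. *)
Lemma path_length_near_left a b c t (d : R) : rectifiable a b c ->
  t \in `[a, b] -> 0 < d ->
  \forall t' \near within `[a, b]%classic (nbhs t),
    t' <= t -> (path_length t' t c < d%:E)%E.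
Proof.
move=> rc tab d0; have [[ab /subspace_continuousP cc] _] := rc.
have /andP[at_ tb] : a <= t <= b by move: tab; rewrite in_itv.
move: (at_); rewrite le_eqVlt => /predU1P[teb|tltb].
  near=> t' => tt'.
  have : t' \in `[a, b] by near: t'; apply: withinT.
  rewrite in_itv /= => /andP[t'b _].
  have <- : t = t' by apply/eqP; rewrite eq_le tt' -teb t'b.
  by rewrite path_lengthxx lte_fin.
have d20 : 0 < d / 2 by rewrite divr_gt0.
have [l0 l00 L0] := rectifiable_length rc (lexx a) at_ tb.
have fin0 : path_length a t c \is a fin_num by rewrite L0.
have [_ [s sp <-]] := @ub_ereal_sup_adherent _
  [set (polygonal_length c a s)%:E | s in itv_partition a t] (d / 2) d20 fin0.
rewrite -/(path_length a t c) L0 -EFinB lte_fin.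
case: (lastP s) sp => {s} [[_ /eqP/= tb'] |s x [/= + /eqP]].
  by move: tltb; rewrite tb' ltxx.
rewrite rcons_path last_rcons polygonal_length_rcons => /andP[p +] xt.
rewrite {}xt; set y := last a s => yt lt.
near=> t' => tt'.
have : t' \in `[a, b] by near: t'; apply: withinT.
rewrite in_itv /= => /andP[at' t'b].
have yt' : (y : R) < t'.
  by near: t'; apply: cvg_within; exact: (@lt_nbhsr R).
have ctt' : mdist (c t) (c t') < d / 2.
  near: t'; have := cc t tab.
  by move=> /metricType_numDomainType.cvgrPdist_lt /(_ _ d20).
have sp' : itv_partition a t' (rcons s t').
  by split; rewrite ?rcons_path ?last_rcons // p.
have := path_length_ge_polygonal c sp'; have := path_length_superadd c at' tt'.
have [l1 _ ->] := rectifiable_length rc at' tt' tb.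
have [l2 _ ->] := rectifiable_length rc (lexx a) at' t'b.
rewrite L0 -EFinD !lee_fin lte_fin polygonal_length_rcons -/y => le1 le2.
have := metric_triangle (c y) (c t') (c t); rewrite [mdist (c t') _]metric_sym.
lra.
Unshelve. all: by end_near. Qed.

End PathLength.

(** * Lifting paths to the level covers *)

Section LevelLift.
Context {R : realType} {X : metricType R} {pt : X} {e : {posnum R}}.
Implicit Types p q z : chain_cover pt e.

(** Splits continuity into a condition in [X] and a condition free of radii, the form in which lifts
    are built and compared. *)
Lemma level_path_onP (a b : R) (c : R -> chain_cover pt e) :
  path_on a b c <->
  path_on a b (@endpoint R X pt e \o c) /\ adj_path adj a b c.
Proof.
split=> [[ab /subspace_continuousP cc]|[/path_on_mdist[ab cc] ac]].
  have near_ball r t : 0 < r -> r <= e%:num -> t \in `[a, b] ->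
      \forall t' \near within `[a, b]%classic (nbhs t),
        cover_ball r (c t, c t').
    move=> r0 re tab; have := cc t tab => /cvg_app_entourageP /(_ (cover_ball r)).
    by apply; exists r => //=; rewrite r0.
  split; last by move=> t tab; exact: near_ball.
  apply/path_on_mdist; split=> // t tab r r0.
  have := @near_ball (Num.min r e%:num) t.
  rewrite lt_min r0 ge_min lexx orbT gt0 => /(_ isT isT tab).
  apply: filterS => t'; rewrite cover_ballE ?ge_min ?lexx ?orbT // lt_min.
  by move=> [_ /andP[]].
split=> //; apply/subspace_continuousP => t tab.
apply/cvg_app_entourageP => A [r /= /andP[r0 re] rA].
near=> t'; apply: rA; rewrite cover_ballE //; split.
  by near: t'; exact: ac.
by near: t'; exact: cc.
Unshelve. all: by end_near. Qed.

(** Continuity of g follows from that of c by [level_path_onP]. *)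
Definition level_lift (a b : R) (c : R -> X) p (g : R -> chain_cover pt e) :=
  [/\ g a = p, {in `[a, b], forall t, endpoint (g t) = c t} & adj_path adj a b g].

(** While the projection oscillates by less than e, each further point is a one-point extension of
    [g u], and any two of these are adjacent through [g u]. *)
Lemma level_lift_extend (a u v : R) (c : R -> X) p g : a <= u -> u <= v ->
  {in `[u, v] &, forall s t, mdist (c s) (c t) < e%:num} ->
  level_lift a u c p g -> exists g', level_lift a v c p g'.
Proof.
move=> au uv osc [ga gc gadj].
have uau : u \in `[a, u] by rewrite in_itv /= au lexx.
have uuv : u \in `[u, v] by rewrite in_itv /= uv lexx.
have [rfl sym _ trs] := @adj_adjacency R X pt e.
(* For s in [u, v] [adj_extend] supplies a point, so [xget] does not fall back on its default. *)
pose q s := xget (g u) [set q | adj (g u) q /\ endpoint q = c s].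
have qP s : s \in `[u, v] -> adj (g u) (q s) /\ endpoint (q s) = c s.
  move=> suv; have [|z z1 z2] := @adj_extend R X pt e (g u) (c s).
    by rewrite gc //; exact: osc.
  have : exists q, [set q | adj (g u) q /\ endpoint q = c s] q by exists z.
  by move=> /(xgetPex (g u)).
exists (fun s => if s <= u then g s else q s); split; first by rewrite au.
  move=> s; rewrite in_itv /= => /andP[as_ sv]; case: leP => su.
    by rewrite gc // in_itv /= as_.
  by case: (qP s) => //; rewrite in_itv /= (ltW su).
move=> s; rewrite in_itv /= => /andP[as_ sv].
case: (ltgtP s u) => su.
- have sau : s \in `[a, u] by rewrite in_itv /= as_ ltW.
  have h : \forall t' \near nbhs s, t' \in `[a, u] -> adj (g s) (g t') := gadj s sau.
  near=> s'.
  have s'u : s' < u by near: s'; apply: cvg_within; exact: (@lt_nbhsl R).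
  rewrite (ltW s'u).
  have : s' \in `[a, v] by near: s'; apply: withinT.
  rewrite in_itv /= => /andP[as' _].
  have : s' \in `[a, u] by rewrite in_itv /= as' ltW.
  by near: s'; apply: cvg_within.
- near=> s'.
  have us' : u < s' by near: s'; apply: cvg_within; exact: (@lt_nbhsr R).
  rewrite leNgt us' /=.
  have : s' \in `[a, v] by near: s'; apply: withinT.
  rewrite in_itv /= => /andP[_ s'v].
  have s1 : s \in `[u, v] by rewrite in_itv /= (ltW su).
  have s2 : s' \in `[u, v] by rewrite in_itv /= (ltW us').
  apply: (trs _ (g u)); [exact/sym/(qP s s1).1|exact: (qP s' s2).1|].
  by rewrite (qP s s1).2 (qP s' s2).2; exact: osc.
- rewrite su.
  have h : \forall t' \near nbhs u, t' \in `[a, u] -> adj (g u) (g t') := gadj u uau.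
  near=> s'.
  have : s' \in `[a, v] by near: s'; apply: withinT.
  rewrite in_itv /= => /andP[as' s'v]; case: leP => us'.
    have : s' \in `[a, u] by rewrite in_itv /= as'.
    by near: s'; apply: cvg_within.
  by apply: (qP s' _).1; rewrite in_itv /= (ltW us').
Unshelve. all: by end_near. Qed.

(** Having a lift up to time t is locally constant in t: it passes to longer intervals by extension
    and to shorter ones by restriction. *)
Lemma level_lift_exists (a b : R) (c : R -> X) p : path_on a b c ->
  endpoint p = c a -> exists g, level_lift a b c p g.
Proof.
move=> /path_on_mdist[ab cc] pa.
suff : {in `[a, b], forall t, exists g, level_lift a t c p g}.
  by apply; rewrite in_itv /= ab lexx.
have restr u v g : u <= v -> level_lift a v c p g -> level_lift a u c p g.
  move=> uv [ga gc gadj].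
  have sub t : t \in `[a, u] -> t \in `[a, v].
    by rewrite !in_itv /= => /andP[-> /le_trans]; exact.
  split=> // t tau; first by apply: gc; exact: sub.
  have h : \forall t' \near nbhs t, t' \in `[a, v] -> adj (g t) (g t') := gadj t (sub _ tau).
  near=> t'; have : t' \in `[a, v] by apply: sub; near: t'; apply: withinT.
  by near: t'; apply: cvg_within.
apply: segment_induction => [t tab|]; last first.
  have [rfl _ _ _] := @adj_adjacency R X pt e.
  exists (cst p); split=> //; last by move=> t _; apply: nearW => t'; exact: rfl.
  by move=> t; rewrite in_itv /= => /le_anti <-.
(* Staying within e / 2 of the value at t bounds the distance of any two values by e. *)
have e2 : 0 < e%:num / 2 by [].
have : \forall t' \near nbhs t, t' \in `[a, b] -> mdist (c t) (c t') < e%:num / 2.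
  exact: cc.
move=> /nbhs_ballP[d /= d0 dP].
near=> t'.
have t'd : ball t d t' by near: t'; apply: cvg_within; exact: nbhsx_ballx.
have t'ab : t' \in `[a, b] by near: t'; apply: withinT.
have tt : ball t d t by exact: ballxx.
have osc u v : ball t d u -> ball t d v -> u \in `[a, b] -> v \in `[a, b] ->
    {in `[u, v] &, forall s t, mdist (c s) (c t) < e%:num}.
  move=> ud vd uab vab.
  have close s : s \in `[u, v] -> mdist (c t) (c s) < e%:num / 2.
    rewrite in_itv /= => /andP[us sv]; apply: dP.
      move: ud vd; rewrite -!ball_normE /= !ltr_distlC => /andP[u1 _] /andP[_ v1].
      by rewrite (lt_le_trans u1) //= (le_lt_trans sv).
    move: uab vab; rewrite !in_itv /= => /andP[u1 _] /andP[_ v1].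
    by rewrite (le_trans u1) //= (le_trans sv).
  move=> s1 s2 /close h1 /close h2; have := metric_triangle (c s1) (c t) (c s2).
  by rewrite (metric_sym (c s1) (c t)); lra.
have aux u v : a <= u -> u <= v ->
    {in `[u, v] &, forall s t, mdist (c s) (c t) < e%:num} ->
    (exists g, level_lift a u c p g) <-> (exists g, level_lift a v c p g).
  move=> au uv o; split=> -[g gl]; last by exists g; exact: restr gl.
  exact: level_lift_extend gl.
have [tt'|t't] := leP t t'.
  by apply: aux => //; [move: tab; rewrite in_itv => /andP[]|exact: osc].
apply: iff_sym; apply: aux (ltW t't) _; last exact: osc.
by move: t'ab; rewrite in_itv => /andP[].
Unshelve. all: by end_near. Qed.

End LevelLift.

(** * The uniform universal cover *)

Section LiftedDistance.
Context {R : realType} {Z : topologicalType} {X : metricType R} (f : Z -> X).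

Lemma lifted_dist_ge_mdist (x y : Z) :
  ((mdist (f x) (f y))%:E <= lifted_dist f x y)%E.
Proof.
apply: le_ereal_inf_tmp => _ [a [b [c [[ab _] <- <- ->]]]].
exact: path_length_ge_mdist.
Qed.

Lemma lifted_dist_ge0 (x y : Z) : (0 <= lifted_dist f x y)%E.
Proof.
by apply: le_trans (lifted_dist_ge_mdist x y); rewrite lee_fin mdist_ge0.
Qed.

Lemma mdist_lt_path_length (a b r : R) (c : R -> X) s t :
  (path_length a b c < r%:E)%E -> s \in `[a, b] -> t \in `[a, b] ->
  mdist (c s) (c t) < r.
Proof.
move=> cr; wlog st : s t / s <= t.
  move=> h sab tab; have [/h|/ltW/h] := leP s t; first exact.
  by rewrite metric_sym; exact.
rewrite !in_itv /= => /andP[as_ _] /andP[_ tb]; rewrite -lte_fin.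
apply: le_lt_trans (path_length_ge_mdist c st) _.
exact: le_lt_trans (path_length_sub c as_ st tb) cr.
Qed.

Lemma path_on_cst (a b : R) (x : Z) : a <= b -> path_on a b (cst x).
Proof.
by move=> ab; split=> //; apply: continuous_subspaceT => t; exact: cvg_cst.
Qed.

(** A path of length below e is compared with the constant path at its start, from which its
    projection never departs by e. *)
Lemma lifted_dist_adj (e : R) adj : adjacency f e adj ->
  (forall (a b : R) (c : R -> Z), path_on a b c ->
     path_on a b (f \o c) /\ adj_path adj a b c) ->
  forall x y, (lifted_dist f x y < e%:E)%E -> adj x y.
Proof.
move=> A P x y /lifted_dist_lt[a [b [c [cp <- <- cl]]]].
have [ab _] := cp; have [cp1 cp2] := P _ _ _ cp.
have [p1 p2] := P _ _ _ (path_on_cst (c a) ab).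
have aab : a \in `[a, b] by rewrite in_itv /= lexx ab.
apply: (@adj_path_close _ _ _ _ _ _ a b (cst (c a)) c A p1 cp1 p2 cp2).
- by move=> t tab; exact: (mdist_lt_path_length cl).
- exact: (adjacency_refl A).
- by rewrite in_itv /= lexx ab.
Qed.

End LiftedDistance.

(** * Adjacency against the lifted metric of a level cover *)

Section LevelMetric.
Context {R : realType} {X : metricType R} {pt : X} {e : {posnum R}}.
Implicit Types p q : chain_cover pt e.

Lemma level_lifted_dist_adj p q :
  (lifted_dist (@endpoint R X pt e) p q < e%:num%:E)%E -> adj p q.
Proof.
apply: lifted_dist_adj; first exact: adj_adjacency.
by move=> a b c /level_path_onP.
Qed.

Lemma length_space_path (x y : X) (r : R) : length_space X -> mdist x y < r ->
  exists (a b : R) (c : R -> X), [/\ path_on a b c, c a = x, c b = y &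
    (path_length a b c < r%:E)%E].
Proof.
move=> [_ lX] xyr; have r0 : 0 < (r - mdist x y) / 2 by rewrite divr_gt0 // subr_gt0.
have [a [b [c [h1 h2 h3 h4]]]] := lX x y _ r0.
exists a, b, c; split=> //; apply: le_lt_trans h4 _; rewrite lte_fin; lra.
Qed.

(** The lift from p of a short path of [X] stays adjacent to p, so it ends at a point adjacent to q
    with the endpoint of q, which is q itself. *)
Lemma adj_lifted_dist p q (r : R) : length_space X -> adj p q ->
  mdist (endpoint p) (endpoint q) < r ->
  (lifted_dist (@endpoint R X pt e) p q < r%:E)%E.
Proof.
move=> lX apq pqr.
have A := @adj_adjacency R X pt e.
(* Below r for the estimate, below e so that the lift stays adjacent to p. *)
have : mdist (endpoint p) (endpoint q) < Num.min r e%:num.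
  by rewrite lt_min pqr (adjacency_mdist A).
move=> /(length_space_path lX)[a [b [c [cp ca cb cl]]]].
have [g [ga gc gadj]] := level_lift_exists cp (esym ca).
have [ab _] := cp.
have aab : a \in `[a, b] by rewrite in_itv /= lexx ab.
have bab : b \in `[a, b] by rewrite in_itv /= lexx ab.
have gp : path_on a b (@endpoint R X pt e \o g).
  split=> //; apply: subspace_eq_continuous cp.2 => t; rewrite inE => tab.
  by rewrite /from_subspace /= gc.
have gp' : path_on a b g by apply/level_path_onP.
have apg : adj p (g b).
  apply: (@adj_path_close _ _ _ _ _ _ a b (cst p) g A) => //.
  - exact: (path_on_cst (endpoint p) ab).
  - by move=> t _; apply: nearW => t'; exact: (adjacency_refl A).
  - move=> t tab /=; rewrite gc // -ga gc //.
    have := mdist_lt_path_length cl aab tab.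
    by rewrite lt_min => /andP[].
  - by rewrite ga; exact: (adjacency_refl A).
have gbq : g b = q.
  apply: adj_eq; last by rewrite gc.
  apply: (adjacency_trans A) apq _; first exact: (adjacency_sym A).
  by rewrite gc // cb mdistxx.
apply: le_lt_trans (lifted_dist_le _ gp' ga gbq) _.
rewrite (@path_length_eq _ _ _ _ _ c) //.
by apply: lt_le_trans cl _; rewrite lee_fin ge_min lexx.
Qed.

End LevelMetric.

(** * Adjacency and path lifting on the inverse limit *)

Section TotalAdjacency.
Context {R : realType} {X : metricType R} {pt : X}.
Implicit Types (d e : {posnum R}) (x y : Xtilde pt).

Lemma bonding_adj d e (h : d%:num < e%:num) (p q : Xeps pt d) :
  adj p q -> adj (bonding h p : chain_cover pt e) (bonding h q).
Proof.
move=> [s [t [y [[-> ->] tE sy]]]]; rewrite !bonding_mk.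
exists (chain_widen h s), (chain_widen h t), y; split=> //.
exact: lt_trans sy h.
Qed.

Lemma endpoint_coord e x : endpoint (coord e x) = phi x.
Proof.
have [e1|e1|e1] := ltgtP e%:num 1.
- have h : e%:num < (1%:pos : {posnum R})%:num by [].
  have E : coord 1%:pos x = bonding h (coord e x) by rewrite /coord coordP.
  by rewrite /phi E endpoint_bonding.
- have h : (1%:pos : {posnum R})%:num < e%:num by [].
  have E : coord e x = bonding h (coord 1%:pos x) by rewrite /coord coordP.
  by rewrite E endpoint_bonding.
- by rewrite (_ : e = 1%:pos) //; apply: val_inj.
Qed.

Definition tadj d x y : Prop :=
  adj (coord d x : chain_cover pt d) (coord d y).

Lemma tadj_adjacency d : adjacency (@phi R X pt) d%:num (tadj d).
Proof.
have [rfl sym dst trs] := @adj_adjacency R X pt d.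
split.
- by move=> x; exact: rfl.
- by move=> x y; exact: sym.
- by move=> x y /dst; rewrite !endpoint_coord.
- by move=> x y z xy yz h; apply: trs xy yz _; rewrite !endpoint_coord.
Qed.

Lemma tadj_le d e x y : d%:num <= e%:num -> tadj d x y -> tadj e x y.
Proof.
rewrite le_eqVlt => /predU1P[/val_inj->//|h].
by rewrite /tadj /coord -!(coordP _ h); exact: bonding_adj.
Qed.

Lemma tadj_eq x y : (forall d, tadj d x y) -> x = y.
Proof.
move=> xy; have pxy : phi x = phi y.
  apply: mdist_positivity; apply/eqP; rewrite eq_le mdist_ge0 andbT.
  apply/ler_addgt0Pr => _/posnumP[d]; rewrite add0r ltW //.
  exact: (adjacency_mdist (tadj_adjacency d)).
by apply: Xtilde_ext => e; apply: adj_eq; [exact: xy|rewrite !endpoint_coord].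
Qed.

(** Adjacency at a fine level implies it at coarser ones, so one small level controls the finitely
    many coordinates that an entourage involves. *)
Lemma Xtilde_entourage (lX : length_space X) (E : set (Xtilde pt * Xtilde pt)) :
  entourage E -> exists d, forall x y, tadj d x y -> E (x, y).
Proof.
pose G := filter_from [set: {posnum R}]
  (fun d => [set xy : Xtilde pt * Xtilde pt | tadj d xy.1 xy.2]).
have GF : Filter G.
  apply: filter_from_filter; first by exists 1%:pos.
  move=> d e _ _; exists (Order.min d e) => // -[x y] /= h.
  by split; apply: tadj_le h; rewrite num_min ge_min lexx ?orbT.
suff GE : entourage E -> G E.
  by move=> /GE [d _ dE]; exists d => x y xy; exact: (dE (x, y)).
(* Entourages of the subspace of the product unfold to finite intersections of coordinate
   entourages. As [G] is a filter, one coordinate i with one radius r suffices, and the level is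
   their minimum. *)
move=> [V [B [F _ <-] BV] VE].
apply: filterS VE _; apply: (@filterS _ G GF _ _ (preimage_subset BV)).
rewrite preimage_bigcap; apply: filter_bigI => -[[i Q] /= iQ] _.
move: iQ => /asboolP [W [r /= r0 rW] WQ].
have r0' : 0 < Num.min r (i : {posnum R})%:num by rewrite lt_min r0 /=.
exists (PosNum r0') => // -[x y] /= xy; apply: WQ; apply: rW.
rewrite /Xeps_ball /=; apply: adj_lifted_dist => //.
  by apply: tadj_le xy; rewrite /= ge_min lexx orbT.
rewrite !endpoint_coord.
have := adjacency_mdist (tadj_adjacency _) xy.
by rewrite /= lt_min => /andP[].
Qed.

Lemma coord_continuous d : continuous (@coord R X pt d : Xtilde pt -> Xeps pt d).
Proof.
move=> x; apply: (@continuous_comp _ _ _ (set_val : Xtilde pt -> _) (proj d)).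
  exact: initial_continuous.
exact: proj_continuous.
Qed.

Lemma Xtilde_path_onP (lX : length_space X) (a b : R) (c : R -> Xtilde pt) :
  path_on a b c <->
  path_on a b (@phi R X pt \o c) /\ forall d, adj_path (tadj d) a b c.
Proof.
split=> [[ab /subspace_continuousP cc]|[/path_on_mdist[ab cc] ac]].
  have near_ball d t : t \in `[a, b] ->
      \forall t' \near within `[a, b]%classic (nbhs t), tadj d (c t) (c t').
    move=> tab; have : coord d \o c @ within `[a, b]%classic (nbhs t) -->
        (coord d (c t) : Xeps pt d).
      exact: cvg_comp (cc t tab) (@coord_continuous d _).
    move=> /cvg_ballP /(_ d%:num (gt0 d)).
    apply: filterS => t' h; exact: level_lifted_dist_adj h.
  split; last by move=> d t tab; exact: near_ball.
  apply/path_on_mdist; split=> // t tab r r0.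
  have := @near_ball (PosNum r0) t tab; apply: filterS => t'.
  exact: (adjacency_mdist (tadj_adjacency _)).
split=> //; apply/subspace_continuousP => t tab.
apply/cvg_app_entourageP => A /(Xtilde_entourage lX)[d dA].
by apply: filterS (ac d t tab) => t'; exact: dA.
Qed.

Lemma phi_path (lX : length_space X) (a b : R) (c : R -> Xtilde pt) :
  path_on a b c -> path_on a b (@phi R X pt \o c).
Proof. by move=> /(Xtilde_path_onP lX)[]. Qed.

(** The level lifts form a thread: the image of the lift at level d and the lift at level e start at
    the same point and have the same projection, so they stay adjacent and are equal. *)
Lemma Xtilde_lift (lX : length_space X) (a b : R) (c : R -> X) (x : Xtilde pt) :
  path_on a b c -> phi x = c a ->
  exists2 g : R -> Xtilde pt, is_lift (@phi R X pt) a b c g & g a = x.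
Proof.
move=> cp xa; have [ab _] := cp.
have lvl e : exists g : R -> chain_cover pt e, level_lift a b c (coord e x) g.
  by apply: level_lift_exists => //; rewrite endpoint_coord.
pose g e := projT1 (cid (lvl e)).
have gP e : level_lift a b c (coord e x) (g e) := projT2 (cid (lvl e)).
have aab : a \in `[a, b] by rewrite in_itv /= lexx ab.
have gp e : path_on a b (@endpoint R X pt e \o g e).
  have [_ gc _] := gP e.
  split=> //; apply: subspace_eq_continuous cp.2 => t; rewrite inE => tab.
  by rewrite /from_subspace /= gc.
have glim t : t \in `[a, b] ->
    inverse_limit ((fun e => g e t) : prod_topology (Xeps_uniform pt)).
  move=> tab d e h; have [da dc dadj] := gP d; have [ea ec eadj] := gP e.
  have A := @adj_adjacency R X pt e.
  apply: adj_eq; last by rewrite endpoint_bonding dc // ec.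
  move: t tab; apply: (@adj_path_close _ _ _ _ _ _ a b
    (fun t => bonding h (g d t) : chain_cover pt e) (g e) A) => //.
  - split=> //; apply: subspace_eq_continuous cp.2 => t; rewrite inE => tab.
    by rewrite /from_subspace /= endpoint_bonding dc.
  - move=> t /dadj; apply: filterS => t'; exact: bonding_adj.
  - by move=> t tab; rewrite endpoint_bonding dc // ec // mdistxx.
  - by rewrite da ea /coord (coordP x h); exact: (adjacency_refl A).
(* Clamping the parameter to [a, b] yields a point of the inverse limit at every real t, as a total
   function requires. *)
pose cl t := Order.max a (Order.min t b).
have clab t : cl t \in `[a, b].
  by rewrite in_itv /= le_max lexx /= ge_max ab /= ge_min lexx orbT.
have clE t : t \in `[a, b] -> cl t = t.
  by rewrite in_itv /cl /= => /andP[at_ tb]; rewrite min_l // max_r.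
pose G t := Xtilde_mk (glim _ (clab t)).
have GE t e : t \in `[a, b] -> coord e (G t) = g e t.
  by move=> tab; rewrite /coord /= clE.
have Gphi t : t \in `[a, b] -> phi (G t) = c t.
  by move=> tab; rewrite -(endpoint_coord 1%:pos) GE //; case: (gP 1%:pos) => _ ->.
exists G; last first.
  by apply: Xtilde_ext => e; rewrite GE //; case: (gP e).
split=> //; apply/(Xtilde_path_onP lX); split.
  split=> //; apply: subspace_eq_continuous cp.2 => t; rewrite inE => tab.
  by rewrite /from_subspace /= Gphi.
move=> d t tab; have [_ _ /(_ t tab) dadj] := gP d.
near=> t'; have tab' : t' \in `[a, b] by near: t'; apply: withinT.
by rewrite /tadj !GE //; near: t'.
Unshelve. all: by end_near. Qed.

Lemma Xtilde_path_close (lX : length_space X) d (a b : R)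
    (g1 g2 : R -> Xtilde pt) : path_on a b g1 -> path_on a b g2 ->
  {in `[a, b], forall t, mdist (phi (g1 t)) (phi (g2 t)) < d%:num} ->
  tadj d (g1 a) (g2 a) -> {in `[a, b], forall t, tadj d (g1 t) (g2 t)}.
Proof.
move=> /(Xtilde_path_onP lX)[p1 a1] /(Xtilde_path_onP lX)[p2 a2].
exact: adj_path_close (tadj_adjacency d) p1 p2 (a1 d) (a2 d).
Qed.

Lemma Xtilde_lift_unique (lX : length_space X) (a b : R)
    (c : R -> X) (g1 g2 : R -> Xtilde pt) :
  is_lift (@phi R X pt) a b c g1 -> is_lift (@phi R X pt) a b c g2 ->
  g1 a = g2 a -> {in `[a, b], g1 =1 g2}.
Proof.
move=> [p1 e1] [p2 e2] ga t tab; apply: tadj_eq => d.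
apply: (Xtilde_path_close lX p1 p2) => //.
  by move=> s sab; rewrite e1 // e2 // mdistxx.
by rewrite ga; exact: (adjacency_refl (tadj_adjacency d)).
Qed.

Lemma dXt_tadj (lX : length_space X) d x y : (dXt x y < d%:num%:E)%E -> tadj d x y.
Proof.
apply: lifted_dist_adj; first exact: tadj_adjacency.
by move=> a b c /(Xtilde_path_onP lX)[h1 h2]; split=> //; exact: h2.
Qed.

End TotalAdjacency.

(** * The metric core *)

Section LiftedDistanceAxioms.
Context {R : realType} {Z : topologicalType} {X : metricType R} (f : Z -> X).

Lemma lifted_dist0 x : lifted_dist f x x = 0%E.
Proof. by apply/eqP; rewrite eq_le lifted_distxx lifted_dist_ge0. Qed.

Lemma lifted_dist_sym x y : lifted_dist f x y = lifted_dist f y x.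
Proof.
apply/eqP; rewrite eq_le; apply/andP; split; rewrite leNgt; apply/negP;
  by move=> /lifted_dist_sym_lt; rewrite ltxx.
Qed.

Lemma lifted_dist_triangle y x z :
  (lifted_dist f x z <= lifted_dist f x y + lifted_dist f y z)%E.
Proof.
have := lifted_dist_ge0 f x y; have := lifted_dist_ge0 f y z.
case E2 : (lifted_dist f y z) => [l2| |] //; last first.
  by rewrite addey ?leey // -ltNye; apply: lt_le_trans (lifted_dist_ge0 _ _ _).
case E1 : (lifted_dist f x y) => [l1| |] // _ _; last by rewrite leey.
apply/lee_addgt0Pr => r r0; rewrite -!EFinD ltW //.
have r2 : 0 < r / 2 by rewrite divr_gt0.
rewrite (_ : l1 + l2 + r = (l1 + r / 2) + (l2 + r / 2)); last lra.
by apply: (lifted_dist_triangle_lt (y := y)); rewrite ?E1 ?E2 lte_fin ltrDl.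
Qed.

End LiftedDistanceAxioms.

Section PathRestriction.
Context {R : realType} {Z : topologicalType}.

Lemma path_on_sub (a b u v : R) (c : R -> Z) : a <= u -> u <= v -> v <= b ->
  path_on a b c -> path_on u v c.
Proof.
move=> au uv vb [_ cc]; split=> //; apply: continuous_subspaceW cc => t /=.
by rewrite !in_itv /= => /andP[/(le_trans au) -> /le_trans]; exact.
Qed.

Lemma path_on_eq (a b : R) (c c' : R -> Z) : {in `[a, b], c =1 c'} ->
  path_on a b c -> path_on a b c'.
Proof.
move=> cc' [ab cp]; split=> //; apply: subspace_eq_continuous cp => t.
by rewrite inE /from_subspace => /cc'.
Qed.

End PathRestriction.

(** * Metric, path lengths and path lifting on the core *)

Section Core.
Context {R : realType} {X : metricType R} (pt : X) (lX : length_space X).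

Lemma dXt_le_length (a b : R) (c : R -> Xtilde pt) s t : path_on a b c ->
  a <= s -> s <= t -> t <= b ->
  (dXt (c s) (c t) <= path_length s t (@phi R X pt \o c))%E.
Proof.
by move=> cp as_ st tb; apply: lifted_dist_le => //; exact: path_on_sub cp.
Qed.

Lemma metric_core_close (x y : Xtilde pt) : metric_core pt x ->
  (dXt y x < +oo)%E -> metric_core pt y.
Proof.
move=> xc yx; apply: le_lt_trans (lifted_dist_triangle _ x _ _) _.
exact: lte_add_pinfty.
Qed.

Lemma dXt_fin (x y : Xtilde pt) : metric_core pt x -> metric_core pt y ->
  dXt x y \is a fin_num.
Proof.
move=> xc yc; rewrite ge0_fin_numE ?lifted_dist_ge0 //.
apply: le_lt_trans (lifted_dist_triangle _ (base pt) _ _) _.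
by apply: lte_add_pinfty => //; rewrite lifted_dist_sym.
Qed.

Lemma dXt_core_metric : core_metric pt.
Proof.
split.
- exact: dXt_fin.
- by move=> x _; exact: lifted_dist0.
- move=> x y _ _ xy; apply: tadj_eq => d; apply: (dXt_tadj lX).
  by rewrite xy lte_fin.
- by move=> x y _ _; exact: lifted_dist_sym.
- by move=> y x z _ _ _; exact: lifted_dist_triangle.
Qed.

Context (h : core_metric pt).

Definition core_mk (x : Xtilde pt) (xc : metric_core pt x) : core_space h :=
  exist _ x (mem_set xc).

Lemma core_val_inj : injective (@core_val R X pt h).
Proof. exact: val_inj. Qed.

Lemma mdist_coreE (x y : core_space h) :
  (mdist x y)%:E = dXt (core_val x) (core_val y).
Proof. exact: core_mdistE. Qed.

Lemma core_phi_lipschitz : one_lipschitz (@core_phi R X pt h).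
Proof.
by move=> x y; rewrite -lee_fin mdist_coreE; exact: lifted_dist_ge_mdist.
Qed.

Lemma core_val_unif_continuous : unif_continuous (@core_val R X pt h).
Proof.
move=> E /(Xtilde_entourage lX)[d dE].
rewrite /nbhs /= -entourage_ballE; exists d%:num => //= -[x y] /=.
rewrite ballEmdist /= => xy; apply: dE; apply: (dXt_tadj lX).
by rewrite -mdist_coreE lte_fin.
Qed.

Lemma core_val_continuous : continuous (@core_val R X pt h).
Proof.
move=> x B /nbhsP[A EA AB].
have nA : entourage ((fun xy : core_space h * core_space h =>
    (core_val xy.1, core_val xy.2)) @^-1` A) := core_val_unif_continuous EA.
apply: (@filterS _ _ (nbhs_filter x) _ _ _ (nbhs_entourage x nA)).
by move=> y /xsectionP yA; apply: AB; apply/xsectionP.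
Qed.

Lemma core_val_path (a b : R) (c : R -> core_space h) :
  path_on a b c -> path_on a b (@core_val R X pt h \o c).
Proof.
move=> [ab /subspace_continuousP cc]; split=> //.
apply/subspace_continuousP => t tab.
exact: cvg_comp (cc t tab) (@core_val_continuous _).
Qed.

Lemma core_phi_path (a b : R) (c : R -> core_space h) :
  path_on a b c -> path_on a b (@core_phi R X pt h \o c).
Proof. by move=> /core_val_path /(phi_path lX). Qed.

(** Each length dominates the chords of the other: [dXt] is at most the length of the projection,
    and [core_phi] is 1-Lipschitz. *)
Lemma core_path_length (a b : R) (c : R -> core_space h) : path_on a b c ->
  path_length a b c = path_length a b (@core_phi R X pt h \o c).
Proof.
move=> cp; have [ab _] := cp; have cp' := core_val_path cp.
apply/eqP; rewrite eq_le; apply/andP; split.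
  apply: (@path_length_le_superadd _ _
    (fun u v => path_length u v (@core_phi R X pt h \o c))) => //.
  - by move=> t; rewrite path_lengthxx.
  - by move=> x y z xy yz; exact: path_length_superadd.
  - by move=> u v au uv vb; rewrite mdist_coreE; exact: (dXt_le_length cp').
apply: (@path_length_le_superadd _ _ (fun u v => path_length u v c)) => //.
- by move=> t; rewrite path_lengthxx.
- by move=> x y z xy yz; exact: path_length_superadd.
- move=> u v au uv vb; apply: le_trans (path_length_ge_mdist c uv).
  by rewrite lee_fin; exact: core_phi_lipschitz.
Qed.

(* Arc length of a rectifiable path is continuous, and it dominates dXt.      *)
Lemma core_path (a b : R) (g : R -> Xtilde pt) : path_on a b g ->
  rectifiable a b (@phi R X pt \o g) -> metric_core pt (g a) ->
  exists c : R -> core_space h,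
    {in `[a, b], forall t, core_val (c t) = g t} /\ path_on a b c.
Proof.
move=> gp rg ga; have [ab _] := gp.
have gc t : t \in `[a, b] -> metric_core pt (g t).
  rewrite in_itv /= => /andP[at_ tb]; apply: (metric_core_close ga).
  rewrite /dXt lifted_dist_sym; apply: le_lt_trans (dXt_le_length gp _ at_ tb) _ => //.
  by have [l _ ->] := rectifiable_length rg (lexx a) at_ tb; rewrite ltry.
(* The default [core_base h] can only occur outside the segment. *)
pose c t := insubd (core_base h) (g t).
have cE t : t \in `[a, b] -> core_val (c t) = g t.
  by move=> tab; rewrite /core_val /c insubdK // inE; exact: gc.
exists c; split=> //; apply/path_on_mdist; split=> // t tab r r0.
have /andP[at_ tb] : a <= t <= b by move: tab; rewrite in_itv.
near=> t'; have tab' : t' \in `[a, b] by near: t'; apply: withinT.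
have /andP[at' t'b] : a <= t' <= b by move: tab'; rewrite in_itv.
rewrite -lte_fin mdist_coreE !cE //; have [tt'|/ltW t't] := leP t t'.
  apply: le_lt_trans (dXt_le_length gp at_ tt' t'b) _.
  by move: tt'; near: t'; exact: path_length_near_right rg tab r0.
rewrite /dXt lifted_dist_sym.
apply: le_lt_trans (dXt_le_length gp at' t't tb) _.
by move: t't; near: t'; exact: path_length_near_left rg tab r0.
Unshelve. all: by end_near. Qed.

Lemma core_lift (a b : R) (c : R -> X) (q : core_space h) :
  rectifiable a b c -> core_phi q = c a ->
  exists g : R -> core_space h, [/\ is_lift (@core_phi R X pt h) a b c g,
    g a = q & path_length a b g = path_length a b c].
Proof.
move=> rc qa; have [cp cl] := rc; have [ab _] := cp.
have aab : a \in `[a, b] by rewrite in_itv /= lexx ab.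
have [g [gp gc] ga] := Xtilde_lift lX cp qa.
have gl : path_length a b (@phi R X pt \o g) = path_length a b c.
  by apply: path_length_eq.
have rg : rectifiable a b (@phi R X pt \o g).
  by split; [exact: phi_path|rewrite gl].
have [|k [kE kp]] := @core_path a b g gp rg.
  by rewrite ga; exact: core_valP.
have kphi : {in `[a, b], @core_phi R X pt h \o k =1 c}.
  by move=> t tab; rewrite /= /core_phi kE // gc.
exists k; split; first by split.
  by apply: core_val_inj; rewrite kE.
by rewrite core_path_length //; exact: path_length_eq.
Qed.

Lemma core_lift_unique (a b : R) (c : R -> X) (g1 g2 : R -> core_space h) :
  is_lift (@core_phi R X pt h) a b c g1 -> is_lift (@core_phi R X pt h) a b c g2 ->
  g1 a = g2 a -> {in `[a, b], g1 =1 g2}.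
Proof.
move=> [p1 e1] [p2 e2] ga t tab; apply: core_val_inj.
suff /(_ t tab) : {in `[a, b], @core_val R X pt h \o g1 =1 @core_val R X pt h \o g2} by [].
apply: (Xtilde_lift_unique lX (c := c)).
- by split; first exact: core_val_path.
- by split; first exact: core_val_path.
- by rewrite /= ga.
Qed.

Lemma core_phi_URL : URL_map (@core_phi R X pt h).
Proof.
split=> [a b c [cp _]|a b c q rc qa]; first exact: core_path_length.
have [g [gl ga gL]] := core_lift rc qa.
exists g; split=> //; first by split; [case: gl|rewrite gL; case: rc].
by move=> g' g'l g'a; apply: core_lift_unique g'l gl _; rewrite ga.
Qed.

(** An almost shortest path of [X] lifts with its length. The control by r is the estimate behind
    the quotient metric. *)
Lemma core_phi_surjective (x : X) (q : core_space h) (r : R) :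
  mdist (core_phi q) x < r ->
  exists2 z : core_space h, core_phi z = x & mdist q z < r.
Proof.
move=> /(length_space_path lX)[a [b [c [cp ca cb cl]]]].
have [ab _] := cp.
have rc : rectifiable a b c by split=> //; exact: lt_trans cl (ltry _).
have [g [[gp gc] ga gL]] := core_lift rc (esym ca).
exists (g b); first by rewrite gc // in_itv /= lexx ab.
rewrite -lte_fin -ga; apply: le_lt_trans (path_length_ge_mdist g ab) _.
by rewrite gL.
Qed.

(** Nearly minimizing paths for [dXt] live in [Xtilde]; since their projections are rectifiable,
    they are paths of the core with the same length. *)
Lemma core_length_space : length_space (core_space h).
Proof.
split.
  have [[x [y xy]] _] := lX.
  have [z zpt] : exists z, z != pt.
    have [ypt|ypt] := eqVneq y pt; last by exists y.
    by exists x; rewrite -ypt.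
  have [|q qz _] := @core_phi_surjective z (core_base h) (mdist pt z + 1).
    by rewrite [core_phi _]endpointE ltrDl.
  exists q, (core_base h); apply: contra_neq zpt => qb.
  by rewrite -qz qb [core_phi _]endpointE.
move=> x y e e0.
have : (dXt (core_val x) (core_val y) < (mdist x y + e)%:E)%E.
  by rewrite -mdist_coreE lte_fin ltrDl.
move=> /lifted_dist_lt[a [b [c [cp ca cb cl]]]]; have [ab _] := cp.
have rc : rectifiable a b (@phi R X pt \o c).
  by split; [exact: phi_path|exact: lt_trans cl (ltry _)].
have [|g [gE gp]] := core_path cp rc; first by rewrite ca; exact: core_valP.
exists a, b, g; split=> //.
- by apply: core_val_inj; rewrite gE ?ca // in_itv /= lexx ab.
- by apply: core_val_inj; rewrite gE ?cb // in_itv /= lexx ab.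
rewrite core_path_length // (@path_length_eq _ _ _ _ _ (@phi R X pt \o c)) ?ltW //.
by move=> t tab /=; rewrite /core_phi gE.
Qed.

(** Almost shortest paths of Y are carried to paths whose projections are no longer. Continuity of g
    makes these images paths of [Xtilde]; otherwise g might jump within a fibre of [phi]. *)
Lemma lipschitz_into_core (Y : metricType R) (g : Y -> Xtilde pt) :
  length_space Y -> continuous g -> (exists y : Y, metric_core pt (g y)) ->
  one_lipschitz (fun y : Y => phi (g y)) ->
  exists g' : Y -> core_space h,
    [/\ forall y : Y, core_val (g' y) = g y, one_lipschitz g' & continuous g'].
Proof.
move=> lY cg [y0 y0c] gl.
have gd y1 y2 : (dXt (g y1) (g y2) <= (mdist y1 y2)%:E)%E.
  apply/lee_addgt0Pr => r r0; rewrite -EFinD.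
  have [_ /(_ y1 y2 r r0)[a [b [c [[ab cp] ca cb cl]]]]] := lY.
  have gp : path_on a b (g \o c).
    split=> //; apply/subspace_continuousP => t tab; move/subspace_continuousP : cp.
    by move=> /(_ t tab) ct; exact: cvg_comp ct (cg _).
  apply: le_trans cl; apply: le_trans (_ : path_length a b (@phi R X pt \o (g \o c)) <= _)%E.
    by apply: lifted_dist_le => //=; [rewrite ca|rewrite cb].
  apply: (@path_length_le_superadd _ _ (fun u v => path_length u v c)) => //.
  - by move=> t; rewrite path_lengthxx.
  - by move=> x y z xy yz; exact: path_length_superadd.
  - move=> u v au uv vb; apply: le_trans (path_length_ge_mdist c uv).
    by rewrite lee_fin; exact: gl.
have gc y : metric_core pt (g y).
  by apply: (metric_core_close y0c); apply: le_lt_trans (gd _ _) _; exact: ltry.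
pose g' y := core_mk (gc y).
have g'l : one_lipschitz g' by move=> y1 y2; rewrite -lee_fin mdist_coreE; exact: gd.
exists g'; split=> // y; apply/metricType_numDomainType.cvgrPdist_lt => r r0.
near=> z; apply: le_lt_trans (g'l _ _) _; near: z.
by apply/metricType_numDomainType.nbhs_mdistP; exists r.
Unshelve. all: by end_near. Qed.

End Core.

(** * Lipschitz homotopies *)

Section Segments.
Context {R : realType}.
Implicit Types (p q o : R * R) (s t k : R).

Definition segment p q t : R * R :=
  (p.1 + t * (q.1 - p.1), p.2 + t * (q.2 - p.2)).

Lemma segment0 p q : segment p q 0 = p.
Proof. by rewrite /segment !mul0r !addr0 -surjective_pairing. Qed.

Lemma segment1 p q : segment p q 1 = q.
Proof. by rewrite /segment !mul1r !(addrC p.1) !(addrC p.2) !subrK -surjective_pairing. Qed.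

Lemma euclidean_dist_scale (p q p' q' : R * R) k :
  p.1 - q.1 = k * (p'.1 - q'.1) -> p.2 - q.2 = k * (p'.2 - q'.2) ->
  euclidean_dist p q = `|k| * euclidean_dist p' q'.
Proof.
rewrite /euclidean_dist => -> ->.
by rewrite !exprMn -mulrDr sqrtrM ?sqr_ge0 // sqrtr_sqr.
Qed.

Lemma euclidean_dist_segment p q s t :
  euclidean_dist (segment p q s) (segment p q t) = `|s - t| * euclidean_dist p q.
Proof.
by rewrite distrC; apply: euclidean_dist_scale; rewrite /=; ring.
Qed.

Lemma euclidean_dist_cone o p q t :
  euclidean_dist (segment o p t) (segment o q t) = `|t| * euclidean_dist p q.
Proof. by apply: euclidean_dist_scale; rewrite /=; ring. Qed.

Lemma euclidean_dist_ge0 p q : 0 <= euclidean_dist p q.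
Proof. exact: sqrtr_ge0. Qed.

(** Links the Euclidean distance to the max-balls of the product topology; it is exact on horizontal
    and vertical segments. *)
Lemma euclidean_dist_le p q : euclidean_dist p q <= `|p.1 - q.1| + `|p.2 - q.2|.
Proof.
set u := p.1 - q.1; set v := p.2 - q.2.
apply: (@le_trans _ _ (Num.sqrt ((`|u| + `|v|) ^+ 2))).
  apply: ler_wsqrtr; rewrite -/u -/v -(real_normK (num_real u)).
  rewrite -(real_normK (num_real v)) sqrrD lerD2r lerDl.
  by rewrite mulrn_wge0 // mulr_ge0.
by rewrite sqrtr_sqr ger0_norm // addr_ge0.
Qed.

Lemma rectangle_segment (a b T : R) p q t : rectangle a b T p ->
  rectangle a b T q -> t \in `[0, 1] -> rectangle a b T (segment p q t).
Proof.
rewrite /rectangle /= !in_itv /= => -[/andP[p1 p2] /andP[p3 p4]].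
move=> [/andP[q1 q2] /andP[q3 q4]] /andP[t0 t1].
by split; apply/andP; split; nra.
Qed.

End Segments.

Section LipschitzPath.
Context {R : realType} {X : metricType R}.

Lemma lipschitz_path (a b k : R) (c : R -> X) : a <= b ->
  {in `[a, b] &, forall s t, mdist (c s) (c t) <= k * `|s - t|} ->
  path_on a b c.
Proof.
move=> ab lc; apply/path_on_mdist; split=> // t tab e e0.
have d0 : 0 < e / (`|k| + 1) by rewrite divr_gt0 // ltr_wpDl.
near=> t'; have tab' : t' \in `[a, b] by near: t'; apply: withinT.
apply: le_lt_trans (lc _ _ tab tab') _.
have : ball t (e / (`|k| + 1)) t'.
  by near: t'; apply: cvg_within; exact: nbhsx_ballx.
rewrite -ball_normE /= ltr_pdivlMr ?ltr_wpDl //; apply: le_lt_trans.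
rewrite mulrC ler_wpM2l //; apply: le_trans (ler_norm k) _.
by rewrite lerDl.
Unshelve. all: by end_near. Qed.

End LipschitzPath.

(** * Lifting Lipschitz homotopies along straight segments *)

Section HomotopyLifting.
Context {R : realType} {X : metricType R} (pt : X) (lX : length_space X).
Context (h : core_metric pt).

(* The lift at p is the endpoint of the lift of the straight segment from     *)
(* (a, 0) to p; along segments it is a path whose projection has length at    *)
(* most the Euclidean distance of the endpoints.                              *)
Lemma lipschitz_homotopy_lift (a b T : R) (H : R * R -> X) (x0 : core_space h) :
  lipschitz_homotopy a b T H -> core_phi x0 = H (a, 0) ->
  exists HL : R * R -> core_space h,
    [/\ HL (a, 0) = x0,
        forall p, rectangle a b T p -> core_phi (HL p) = H p &
        forall p q, rectangle a b T p -> rectangle a b T q ->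
          mdist (HL p) (HL q) <= euclidean_dist p q].
Proof.
move=> [ab T0 Hlip] x0E; set K := rectangle a b T in Hlip *.
have Ko : K (a, 0) by rewrite /K /rectangle /= !in_itv /= !lexx ab ltW.
set o := (a, 0) in Ko x0E *.
have i0 : (0 : R) \in `[0, 1] by rewrite in_itv /= lexx ler01.
have i1 : (1 : R) \in `[0, 1] by rewrite in_itv /= lexx ler01.
have segp p q : K p -> K q -> path_on 0 1 (H \o segment p q).
  move=> Kp Kq; apply: (lipschitz_path (k := euclidean_dist p q)) => //.
  move=> s t s01 t01; apply: le_trans (Hlip _ _ _ _) _;
    try exact: rectangle_segment.
  by rewrite euclidean_dist_segment mulrC.
have : forall p, exists g : R -> Xtilde pt, K p ->
    is_lift (@phi R X pt) 0 1 (H \o segment o p) g /\ g 0 = core_val x0.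
  move=> p; have [Kp|nKp] := pselect (K p); last by exists (cst (core_val x0)).
  have [|g g1 g2] := Xtilde_lift lX (segp o p Ko Kp) (x := core_val x0).
    by rewrite /= segment0.
  by exists g.
move=> /choice[G GP].
have Gphi p t : K p -> t \in `[0, 1] -> phi (G p t) = H (segment o p t).
  by move=> Kp t01; have [[_ ->]] := GP p Kp.
(* Contraction towards o shrinks distances, so the segments from o to p and to q run within d of
   each other and their lifts remain adjacent. *)
have Gadj (d : {posnum R}) p q : K p -> K q -> euclidean_dist p q < d%:num ->
    tadj d (G p 1) (G q 1).
  move=> Kp Kq pq; have [[Gp1 Gp2] Gp3] := GP p Kp.
  have [[Gq1 Gq2] Gq3] := GP q Kq.
  apply: (Xtilde_path_close lX Gp1 Gq1) => //; last first.
    by rewrite Gp3 Gq3; exact: (adjacency_refl (tadj_adjacency d)).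
  move=> t t01; rewrite !Gphi //; apply: le_lt_trans pq.
  apply: le_trans (Hlip _ _ _ _) _; try exact: rectangle_segment.
  move: t01; rewrite in_itv /= euclidean_dist_cone => /andP[t0 t1].
  by rewrite ger0_norm // ler_piMl // euclidean_dist_ge0.
have Gseg p q : K p -> K q -> path_on 0 1 (fun t => G (segment p q t) 1).
  move=> Kp Kq; apply/(Xtilde_path_onP lX); split.
    apply: path_on_eq (segp p q Kp Kq) => t t01 /=.
    by rewrite Gphi ?segment1 //; exact: rectangle_segment.
  move=> d t t01.
  (* The added 1 keeps the denominator positive when p = q. *)
  have d0 : 0 < d%:num / (euclidean_dist p q + 1).
    by rewrite divr_gt0 // ltr_wpDl // euclidean_dist_ge0.
  near=> t'; have t01' : t' \in `[0, 1] by near: t'; apply: withinT.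
  apply: Gadj; try exact: rectangle_segment.
  have : ball t (d%:num / (euclidean_dist p q + 1)) t'.
    by near: t'; apply: cvg_within; exact: nbhsx_ballx.
  rewrite -ball_normE /= euclidean_dist_segment.
  rewrite ltr_pdivlMr ?ltr_wpDl ?euclidean_dist_ge0 //; apply: le_lt_trans.
  by rewrite ler_wpM2l // lerDl.
have Gd p q : K p -> K q ->
    (dXt (G p 1%R) (G q 1%R) <= (euclidean_dist p q)%:E)%E.
  move=> Kp Kq; have gp := Gseg p q Kp Kq.
  apply: le_trans (lifted_dist_le (@phi R X pt) gp _ _) _; rewrite ?segment0 ?segment1 //.
  rewrite (@path_length_eq _ _ _ _ _ (H \o segment p q)); last first.
    by move=> t t01 /=; rewrite Gphi ?segment1 //; exact: rectangle_segment.
  rewrite -[euclidean_dist p q]mulr1 -[X in _ * X]subr0; apply: path_length_lipschitz => //.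
  move=> u v u0 uv v1.
  have ui : u \in `[0, 1] by rewrite in_itv /= u0 (le_trans uv).
  have vi : v \in `[0, 1] by rewrite in_itv /= v1 (le_trans u0).
  apply: le_trans (Hlip _ _ _ _) _; try exact: rectangle_segment.
  by rewrite euclidean_dist_segment distrC ger0_norm ?subr_ge0 // mulrC.
have Go : G o 1 = core_val x0.
  have [Go1 Go2] := GP o Ko.
  have : {in `[0, 1], G o =1 cst (core_val x0)}.
    apply: (Xtilde_lift_unique lX Go1) => //; split; first exact: path_on_cst.
    move=> t _ /=; rewrite /segment !subrr !mulr0 !addr0; exact: x0E.
  by move=> ->.
have Gc p : K p -> metric_core pt (G p 1).
  move=> Kp; apply: (@metric_core_close _ _ _ (core_val x0)); first exact: core_valP.
  by rewrite -Go; apply: le_lt_trans (Gd _ _ Kp Ko) _; exact: ltry.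
pose HL p : core_space h := insubd (core_base h) (G p 1).
have HLE p : K p -> core_val (HL p) = G p 1.
  by move=> Kp; rewrite /core_val /HL insubdK // inE; exact: Gc.
exists HL; split.
- by apply: core_val_inj; rewrite HLE.
- by move=> p Kp; rewrite /core_phi HLE // Gphi // segment1.
- by move=> p q Kp Kq; rewrite -lee_fin mdist_coreE !HLE //; exact: Gd.
Unshelve. all: by end_near. Qed.

Lemma lipschitz_rectangle_continuous (Z : metricType R) (a b T : R)
    (H : R * R -> Z) :
  (forall p q, rectangle a b T p -> rectangle a b T q ->
     mdist (H p) (H q) <= euclidean_dist p q) ->
  {within rectangle a b T, continuous H}.
Proof.
move=> Hlip; apply/subspace_continuousP => p Kp.
apply/metricType_numDomainType.cvgrPdist_lt => e e0.
have e2 : 0 < e / 2 by rewrite divr_gt0.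
near=> q; have Kq : rectangle a b T q by near: q; apply: withinT.
apply: le_lt_trans (Hlip _ _ Kp Kq) _; apply: le_lt_trans (euclidean_dist_le _ _) _.
have : ball p (e / 2) q by near: q; apply: cvg_within; exact: nbhsx_ballx.
by case; rewrite -!ball_normE /= => h1 h2; rewrite [e]splitr ltrD.
Unshelve. all: by end_near. Qed.

(** Three sides of the rectangle are mapped to [pt], so by uniqueness of lifts the lifted homotopy
    is constant along them. Thus (a, 0) and (b, 0) receive the same point, and the fourth side is
    the lift of c. *)
Lemma H_L_lift_loop (a b : R) (c : R -> X) (cL : R -> core_space h) :
  H_L pt a b c -> is_lift (@core_phi R X pt h) a b c cL ->
  cL a = core_base h -> cL b = core_base h.
Proof.
move=> [_ [T [H [HH Ht Hs]]]] cLl cLa; have [ab T0 _] := HH.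
have aab : a \in `[a, b] by rewrite in_itv /= lexx ab.
have bab : b \in `[a, b] by rewrite in_itv /= lexx ab.
have i0 : 0 \in `[0, T] by rewrite in_itv /= lexx ltW.
have iT : T \in `[0, T] by rewrite in_itv /= lexx ltW.
have bphi : core_phi (core_base h) = pt by rewrite [LHS]endpointE.
have [|HL [HLo HLphi HLlip]] := @lipschitz_homotopy_lift a b T H (core_base h) HH.
  by rewrite bphi (Hs 0 i0).1.
have KT t s : t \in `[a, b] -> s \in `[0, T] -> rectangle a b T (t, s) by [].
have horiz s : s \in `[0, T] -> path_on a b (fun t => HL (t, s)).
  move=> si; apply: (lipschitz_path (k := 1)) => // t t' ti ti'.
  apply: le_trans (HLlip _ _ (KT _ _ ti si) (KT _ _ ti' si)) _.
  by apply: le_trans (euclidean_dist_le _ _) _; rewrite /= subrr normr0 addr0 mul1r.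
have vert t : t \in `[a, b] -> path_on 0 T (fun s => HL (t, s)).
  move=> ti; apply: (lipschitz_path (k := 1)); first exact: ltW.
  move=> s s' si si'.
  apply: le_trans (HLlip _ _ (KT _ _ ti si) (KT _ _ ti si')) _.
  by apply: le_trans (euclidean_dist_le _ _) _; rewrite /= subrr normr0 add0r mul1r.
have cstl (u v : R) (x : core_space h) : u <= v ->
    is_lift (@core_phi R X pt h) u v (cst (core_phi x)) (cst x).
  by move=> uv; split=> //; exact: path_on_cst.
have HLaT : HL (a, T) = core_base h.
  suff e : {in `[0, T], (fun s => HL (a, s)) =1 cst (HL (a, 0))} by rewrite e.
  apply: (core_lift_unique lX _ (cstl _ _ _ (ltW T0))) => //.
  split; first exact: vert.
  by move=> s si /=; rewrite HLphi ?HLo ?bphi //; case: (Hs s si).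
have HLbT : HL (b, T) = core_base h.
  suff e : {in `[a, b], (fun t => HL (t, T)) =1 cst (HL (a, T))} by rewrite e.
  apply: (core_lift_unique lX _ (cstl _ _ _ ab)) => //.
  split; first exact: horiz.
  by move=> t ti /=; rewrite HLphi ?HLaT ?bphi //; case: (Ht t ti).
have HLb0 : HL (b, 0) = core_base h.
  suff e : {in `[0, T], (fun s => HL (b, s)) =1 cst (HL (b, 0))}.
    by rewrite -HLbT (e T).
  apply: (core_lift_unique lX _ (cstl _ _ _ (ltW T0))) => //.
  split; first exact: vert.
  by move=> s si /=; rewrite !HLphi ?(Hs s si).2 ?(Hs 0 i0).2 //; exact: KT.
rewrite -HLb0.
suff e : {in `[a, b], cL =1 (fun t => HL (t, 0))} by rewrite e.
apply: (core_lift_unique lX cLl); last by rewrite HLo.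
split; first exact: horiz.
by move=> t ti /=; rewrite HLphi //; case: (Ht t ti).
Qed.

End HomotopyLifting.

(** * Completeness *)

Section PathSurgery.
Context {R : realType} {Z : topologicalType} {X : metricType R}.

Lemma path_glue (a b e : R) (c c' : R -> Z) : path_on a b c -> path_on b e c' ->
  c b = c' b -> path_on a e (fun t => if t <= b then c t else c' t).
Proof.
move=> [ab cc] [be cc'] cb; split; first exact: le_trans be.
apply: (@continuous_subspaceW _ _ _ (`[a, b] `|` `[b, e])).
  move=> t /=; rewrite !in_itv /= => /andP[at_ te].
  by have [tb|bt] := leP t b; [left; rewrite at_|right; rewrite (ltW bt)].
apply: withinU_continuous; [exact: interval_closed|exact: interval_closed| |].
  apply: subspace_eq_continuous cc => t; rewrite inE /= in_itv /= => /andP[_ tb].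
  by rewrite /from_subspace tb.
apply: subspace_eq_continuous cc' => t; rewrite inE /= in_itv /= => /andP[bt _].
rewrite /from_subspace; case: leP => // tb.
by have -> : t = b by apply/eqP; rewrite eq_le bt tb.
Qed.

Lemma path_reparam (f : Z -> X) (a b u v : R) (c : R -> Z) :
  path_on a b c -> u < v -> exists c' : R -> Z,
    [/\ path_on u v c', c' u = c a, c' v = c b &
        (path_length u v (f \o c') <= path_length a b (f \o c))%E].
Proof.
move=> cp uv; have [ab _] := cp; have vu0 : 0 < v - u by rewrite subr_gt0.
move: ab; rewrite le_eqVlt => /predU1P[<-|ab].
  exists (cst (c a)); split=> //; first exact/path_on_cst/ltW.
  rewrite (_ : f \o cst (c a) = cst (f (c a))) //.
  by rewrite (path_length_cst _ (ltW uv)) path_length_ge0.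
pose k := (b - a) / (v - u); have k0 : 0 < k by rewrite divr_gt0 // subr_gt0.
pose s t := a + k * (t - u).
have su : s u = a by rewrite /s subrr mulr0 addr0.
have sv : s v = b by rewrite /s /k divfK ?gt_eqF // addrC subrK.
have sm : {homo s : x y / x < y}.
  by move=> x y xy; rewrite /s ltrD2l ltr_pM2l // ltrD2r.
exists (c \o s); split; rewrite /= ?su ?sv //.
  apply: path_on_comp cp; first exact: ltW.
    move=> t; apply: cvgD; first exact: cvg_cst.
    apply: cvgM; first exact: cvg_cst.
    by apply: cvgB; [exact: cvg_id|exact: cvg_cst].
  move=> t /andP[ut tv]; rewrite -{1}su -sv /s.
  by rewrite !lerD2l !ler_pM2l // !lerD2r ut tv.
exact: (path_length_comp_le sm su sv).
Qed.

End PathSurgery.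

Section Completeness.
Context {R : realType} {X : metricType R} (pt : X) (lX : length_space X).
Context (h : core_metric pt).

(** [r n] is the radius of the n-th ball; [u n], at distance [r n] from 1, is the time at which the
    limiting path passes the n-th centre. *)
Let r n : R := 2^-1 ^+ n.
Let u n : R := 1 - r n.

Let r_gt0 n : 0 < r n. Proof. by rewrite exprn_gt0 // invr_gt0. Qed.

Let rS n : r n = 2 * r n.+1.
Proof. by rewrite /r exprS mulrA mulfV // mul1r. Qed.

Let r_small (e : R) : 0 < e -> exists n, r n < e.
Proof.
move=> e0; exists (Num.bound e^-1); rewrite /r exprVn.
rewrite -[ltRHS]invrK ltf_pV2 ?posrE ?invr_gt0 ?exprn_gt0 //.
apply: lt_trans (archi_boundP _) _; first by rewrite invr_ge0 ltW.
by rewrite -natrX ltr_nat ltn_expl.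
Qed.

Let u_lt n : u n < u n.+1.
Proof. by rewrite /u ltrD2l ltrN2 (rS n) ltr_pMl ?ltr1n. Qed.

Let u_le m n : (m <= n)%N -> u m <= u n.
Proof.
move=> /subnK <-; elim: (n - m)%N => // k IH.
by rewrite addSn (le_trans IH) // ltW.
Qed.

Let u0 : u 0 = 0. Proof. by rewrite /u /r expr0 subrr. Qed.

Let u_ge0 n : 0 <= u n. Proof. by rewrite -u0 u_le. Qed.

(** Paths of length at most [2 * r n] on [u n, u n.+1] are glued coherently. The factor 4 arises
    because [r q - r q.+1] is half of [r q]. *)
Lemma telescoping_path (z : nat -> core_space h) :
  (forall n, mdist (z n) (z n.+1) < 2 * r n) ->
  exists G : nat -> R -> core_space h,
    [/\ forall n, path_on 0 (u n) (G n), forall n, G n (u n) = z n,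
        forall m n, (m <= n)%N -> {in `[0, u m], G n =1 G m} &
        forall m n, (m <= n)%N ->
          (path_length (u m) (u n) (G n) <= (4 * (r m - r n))%:E)%E].
Proof.
move=> zd.
have : forall n, exists k : R -> core_space h, [/\ path_on (u n) (u n.+1) k,
    k (u n) = z n, k (u n.+1) = z n.+1 &
    (path_length (u n) (u n.+1) k <= (2 * r n)%:E)%E].
  move=> n; have [a [b [c [cp ca cb cl]]]] :=
    length_space_path (core_length_space lX h) (zd n).
  have [k [kp ka kb kl]] := path_reparam id cp (u_lt n).
  exists k; split; rewrite ?ka ?kb //.
  exact: le_trans kl (ltW cl).
move=> /choice[k kP].
pose G := fix G n t := if n is m.+1 then (if t <= u m then G m t else k m t)
                       else z 0%N.
have Gu n : G n (u n) = z n.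
  by case: n => // n /=; rewrite leNgt u_lt /=; case: (kP n).
have GS n t : t \in `[0, u n] -> G n.+1 t = G n t.
  by rewrite in_itv /= => /andP[_ ->].
have Gmn m n : (m <= n)%N -> {in `[0, u m], G n =1 G m}.
  move=> /subnK <-; elim: (n - m)%N => // j IH t tm.
  rewrite addSn GS ?IH //; move: tm; rewrite !in_itv /= => /andP[-> tm] /=.
  by rewrite (le_trans tm) // u_le // leq_addl.
exists G; split => //.
  elim=> [|n IH]; first by rewrite u0; exact: path_on_cst.
  by apply: path_glue IH _ _; rewrite ?Gu; case: (kP n).
move=> m n mn; rewrite -(subnK mn); elim: (n - m)%N => [|j IH].
  by rewrite add0n path_lengthxx subrr mulr0.
rewrite addSn; set q := (j + m)%N in IH *.
have mq : (m <= q)%N by rewrite leq_addl.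
apply: le_trans (path_length_split _ (u_le mq) (ltW (u_lt q))) _.
have -> : 4 * (r m - r q.+1) = 4 * (r m - r q) + 2 * r q by rewrite (rS q); ring.
rewrite EFinD; apply: leeD.
  rewrite (@path_length_eq _ _ _ _ _ (G q)) // => t.
  rewrite in_itv /= => /andP[mt tq]; apply: GS.
  by rewrite in_itv /= tq andbT (le_trans _ mt).
have [_ kq _ kl] := kP q.
rewrite (@path_length_eq _ _ _ _ _ (k q)) // => t.
rewrite in_itv /= => /andP[qt _]; case: leP => // tq.
have -> : t = u q by apply/eqP; rewrite eq_le qt tq.
by rewrite Gu kq.
Qed.

(* The points z n are joined by paths of geometrically decreasing length; the *)
(* limit in X closes their concatenation up to a rectifiable path, whose lift *)
(* ends at the limit in the core.                                             *)
Lemma geometric_sequence_limit (z : nat -> core_space h) (y : X) :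
  (forall n, mdist (z n) (z n.+1) < 2 * r n) ->
  (forall n, mdist (core_phi (z n)) y <= r n) ->
  exists x : core_space h, forall e, 0 < e ->
    exists2 n, r n < e & mdist x (z n) < e.
Proof.
move=> zd zy; have [G [Gp Gu Gmn Gl]] := telescoping_path zd.
have : forall t, exists n, t < 1 -> t < u n.
  move=> t; have [t1|t1] := ltP t 1; last by exists 0%N.
  have [|n nt] := r_small (e := 1 - t); first by rewrite subr_gt0.
  by exists n => _; rewrite /u ltrBrDr addrC -ltrBrDr.
move=> /choice[N NP].
(* Coherence of the [G n] makes the value independent of the choice of [N t]; y fills in time 1. *)
pose c t := if t < 1 then core_phi (G (N t) t) else y.
have cE n t : 0 <= t -> t <= u n -> c t = core_phi (G n t).
  move=> t0 tn; have t1 : t < 1.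
    by apply: le_lt_trans tn _; rewrite /u ltrBlDr ltrDl.
  have tN := ltW (NP t t1).
  rewrite /c t1; congr (core_phi _).
  have [nm|/ltnW nm] := leqP (N t) n; first by rewrite (Gmn _ _ nm) // in_itv /= t0.
  by rewrite (Gmn _ _ nm) // in_itv /= t0.
have c1 : c 1 = y by rewrite /c ltxx.
have cp n : path_on 0 (u n) (@core_phi R X pt h \o G n).
  exact: (core_phi_path lX).
(* Five is 4 for the length travelled after time [u n], plus 1 for the distance from the projection
   of [z n] to y. *)
have ctail n t : u n <= t -> t <= 1 -> mdist (c t) y <= 5 * r n.
  move=> nt; rewrite le_eqVlt => /predU1P[->|t1].
    by rewrite c1 mdistxx mulr_ge0 // ltW.
  have t0 : 0 <= t by exact: le_trans nt.
  pose m := maxn n (N t).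
  have nm : (n <= m)%N by rewrite leq_maxl.
  have tm : t <= u m.
    by apply: le_trans (ltW (NP t t1)) _; rewrite u_le // leq_maxr.
  rewrite (cE m) //.
  have lip := core_phi_lipschitz (G m t) (G m (u n)).
  have : ((mdist (G m (u n)) (G m t))%:E <= (4 * (r n - r m))%:E)%E.
    apply: le_trans (Gl _ _ nm).
    apply: le_trans (path_length_ge_mdist _ nt) _.
    exact: path_length_sub.
  have nn : u n \in `[0, u n] by rewrite in_itv /= u_ge0 lexx.
  rewrite lee_fin (Gmn _ _ nm _ nn) Gu in lip * => hd.
  have := zy n; have := metric_triangle (core_phi (G m t)) (core_phi (z n)) y.
  rewrite metric_sym in hd.
  have := r_gt0 m; lra.
have cpath : path_on 0 1 c.
  apply/path_on_mdist; split=> // t t01 e e0.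
  have /andP[t0 t1] : 0 <= t <= 1 by move: t01; rewrite in_itv.
  move: t1; rewrite le_eqVlt => /predU1P[t1|t1].
    have e5 : 0 < e / 5 by rewrite divr_gt0.
    have [n rn] := r_small e5; have un1 : u n < t by rewrite t1 /u ltrBlDr ltrDl.
    near=> t'.
    have : t' \in `[0, 1] by near: t'; apply: withinT.
    rewrite in_itv /= => /andP[_ t'1].
    have ut' : u n <= t'.
      by apply: ltW; near: t'; apply: cvg_within; exact: (@lt_nbhsr R).
    rewrite t1 c1 metric_sym; apply: le_lt_trans (ctail n _ ut' t'1) _; lra.
  have tN := NP t t1.
  have /path_on_mdist[_ cc] := cp (N t).
  have tN01 : t \in `[0, u (N t)] by rewrite in_itv /= t0 ltW.
  have near_t : \forall t' \near nbhs t, t' \in `[0, u (N t)] ->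
      mdist (core_phi (G (N t) t)) (core_phi (G (N t) t')) < e := cc t tN01 e e0.
  near=> t'.
  have : t' \in `[0, 1] by near: t'; apply: withinT.
  rewrite in_itv /= => /andP[t'0 _].
  have t'N : t' < u (N t) by near: t'; apply: cvg_within; exact: (@lt_nbhsl R).
  rewrite (cE (N t) t t0 (ltW tN)) (cE (N t) t' t'0 (ltW t'N)).
  have : t' \in `[0, u (N t)] by rewrite in_itv /= t'0 ltW.
  by near: t'; apply: cvg_within.
(* Nine is 4 for the nodes of a partition before time 1, plus 5 for its last chord, by [ctail] at
   0. *)
have clen : (path_length 0 1%R c <= 9%:E)%E.
  apply: ge_ereal_sup => _ [s [sp /eqP sl] <-].
  case: (lastP s) sp sl => {s} [_ /= /eqP|s w].
    by rewrite eq_sym oner_eq0.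
  rewrite rcons_path last_rcons => /andP[p +] w1; rewrite {}w1.
  set v := last 0 s => v1.
  have sv : itv_partition 0 v s by split.
  have v0 : 0 <= v by exact: itv_partition_le sv.
  have h1 := path_length_ge_polygonal c sv.
  have vN := ltW (NP v v1).
  have h2 : (path_length 0 v c <= (4 * (r 0 - r (N v)))%:E)%E.
    apply: le_trans (Gl _ _ (leq0n _)); rewrite u0.
    apply: le_trans (path_length_sub c (lexx 0) v0 vN) _.
    rewrite (core_path_length lX) // (@path_length_eq _ _ _ _ _ (@core_phi R X pt h \o G (N v))) //.
    by move=> t; rewrite in_itv /= => /andP[t0 tN]; exact: cE.
  have := le_trans h1 h2; rewrite lee_fin polygonal_length_rcons -/v c1.
  have := ctail 0%N v; rewrite u0 => /(_ v0 (ltW v1)).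
  rewrite lee_fin /r expr0 -/(r (N v)); have := r_gt0 (N v); lra.
have rc : rectifiable 0 1 c by split=> //; exact: le_lt_trans clen (ltry _).
have [|g [[gp gc] ga _]] := core_lift lX (h := h) rc (q := z 0%N).
  by rewrite (cE 0%N) ?u0 // -[in G _ _]u0 Gu.
(* On [0, u n] both g and [G n] lift c from [z 0], so the lift passes through every [z n] and its
   end at time 1 is their limit. *)
have gz n : g (u n) = z n.
  have un1 : u n <= 1 by rewrite /u lerBlDr lerDl ltW.
  suff e : {in `[0, u n], g =1 G n}.
    by rewrite e ?Gu // in_itv /= u_ge0 lexx.
  apply: (@core_lift_unique _ _ _ lX _ _ _ c).
  - split; first by apply: path_on_sub gp.
    move=> t; rewrite in_itv /= => /andP[t0 tn]; apply: gc.
    by rewrite in_itv /= t0 (le_trans tn).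
  - by split=> // t; rewrite in_itv /= => /andP[t0 tn]; rewrite (cE n).
  - have z0 : (0 : R) \in `[0, u 0] by rewrite in_itv /= u0 lexx.
    by rewrite ga (Gmn _ _ (leq0n n) _ z0) -[in RHS]u0 Gu.
exists (g 1) => e e0.
have i1 : (1 : R) \in `[0, 1] by rewrite in_itv /= lexx ler01.
have /path_on_mdist[_ gcont] := gp.
have : \forall t' \near nbhs (1 : R), t' \in `[0, 1] -> mdist (g 1) (g t') < e := gcont 1 i1 e e0.
move=> /nbhs_ballP[d /= d0 dP].
have [|n] := r_small (e := Num.min d e); first by rewrite lt_min d0.
rewrite lt_min => /andP[nd ne]; exists n => //; rewrite -gz; apply: dP.
  by rewrite -ball_normE /= /u opprB addrC subrK ger0_norm // ltW.
by rewrite in_itv /= u_ge0 /u lerBlDr lerDl ltW.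
Unshelve. all: by end_near. Qed.

(** Consecutive balls in the filter meet, which gives the bound [2 * r n]; the projected filter
    supplies y. A single centre near the limit, with small radius, then controls the filter. *)
Lemma core_complete : complete_space X -> complete_space (core_space h).
Proof.
move=> cX F FF Fc.
have cex : cauchy_ex F by exact/cauchyP.
have : forall n, exists x, F (ball x (r n)) by move=> n; exact: cex.
move=> /choice[z zP].
have FX : cauchy (fmap (@core_phi R X pt h) F).
  apply: cauchy_exP => e e0; have [x xP] := cex e e0.
  exists (core_phi x); rewrite /fmap /=; apply: filterS xP => w.
  by rewrite !ballEmdist /=; apply: le_lt_trans; exact: core_phi_lipschitz.
have [y Fy] := cX _ _ FX.
have zd n : mdist (z n) (z n.+1) < 2 * r n.
  have [w [w1 w2]] := filter_ex (filterI (zP n) (zP n.+1)).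
  rewrite !ballEmdist /= in w1 w2.
  have := metric_triangle (z n) w (z n.+1); rewrite (metric_sym w).
  have := rS n; have := r_gt0 n.+1; lra.
have zy n : mdist (core_phi (z n)) y <= r n.
  apply/ler_addgt0Pr => e e0.
  have Fye : F [set x | mdist y (core_phi x) < e].
    by move/metricType_numDomainType.fcvgrPdist_lt : Fy => /(_ e e0).
  have [w [w1 w2]] := filter_ex (filterI (zP n) Fye).
  rewrite ballEmdist /= in w1 w2.
  have := metric_triangle (core_phi (z n)) (core_phi w) y.
  have := core_phi_lipschitz (z n) w; rewrite (metric_sym (core_phi w)); lra.
have [x xP] := geometric_sequence_limit zd zy.
exists x; apply/metricType_numDomainType.fcvgrPdist_lt => e e0.
have e2 : 0 < e / 2 by rewrite divr_gt0.
have [n rn xn] := xP _ e2.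
apply: filterS (zP n) => w; rewrite ballEmdist /= => w1.
have := metric_triangle x (z n) w; lra.
Qed.

End Completeness.

(** * The action of mu *)

Section LevelDeck.
Context {R : realType} {X : metricType R} {pt : X} {e : {posnum R}}.
Implicit Types p q u v : chain_cover pt e.

Lemma cover_cat_adj (u p q : Xeps pt e) : endpoint u = pt -> adj p q ->
  adj (cover_cat u p : chain_cover pt e) (cover_cat u q).
Proof.
rewrite -[u]chain_mk_repr endpointE => uE [s [t [y [[-> ->] tE sy]]]].
rewrite !cover_cat_mk //.
exists (chain_cat (repr u) s), (chain_cat (repr u) t), y; split => //.
  by rewrite !val_chain_cat // tE rcons_cat.
by rewrite /chain_end val_chain_cat // last_cat -/(chain_end (repr u)) uE.
Qed.

(** The common final chain is cancelled by appending its reversal. *)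
Lemma cover_cat_injl (u v p : Xeps pt e) : endpoint u = pt -> endpoint v = pt ->
  cover_cat u p = cover_cat v p -> u = v.
Proof.
rewrite -[u]chain_mk_repr -[v]chain_mk_repr -[p]chain_mk_repr !endpointE.
move: (repr u) (repr v) (repr p) => {u v p} s s' t sE s'E.
rewrite !cover_cat_mk // => /chain_mkP; rewrite !val_chain_cat // => st.
have cancel (w : chain pt e) : chain_end w = pt ->
    chain_homotopic e%:num pt ((val w ++ val t) ++ chain_rev pt (val t)) (val w).
  move=> wE; rewrite -catA -[X in chain_homotopic _ _ _ X]cats0.
  apply: chain_homotopic_catl; first exact: valP.
  by rewrite -/(chain_end w) wE; apply: chain_homotopic_revr; exact: valP.
apply/chain_mkP; apply: rst_trans (cancel _ s'E).
apply: rst_trans (rst_sym _ _ _ _ (cancel _ sE)) _.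
apply: chain_homotopic_catr st.
by rewrite last_cat -/(chain_end s) sE path_chain_rev; exact: valP.
Qed.

(** The loop runs along a chain of q and back along a chain of p. *)
Lemma cover_cat_transitive (p q : Xeps pt e) : endpoint p = endpoint q ->
  exists2 u : Xeps pt e, endpoint u = pt & cover_cat u p = q.
Proof.
rewrite -[p]chain_mk_repr -[q]chain_mk_repr !endpointE.
move: (repr p) (repr q) => {p q} s t st.
have up : path (close e%:num) pt (val t ++ chain_rev pt (val s)).
  rewrite cat_path (valP t) /= -/(chain_end t) -st path_chain_rev; exact: valP.
pose u : chain pt e := exist (fun s => is_true (path (close e%:num) pt s)) _ up.
have uE : chain_end u = pt.
  by rewrite /chain_end /= last_cat -/(chain_end t) -st last_rev_belast.
exists (chain_mk u); first by rewrite endpointE.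
rewrite cover_cat_mk //; apply/chain_mkP; rewrite val_chain_cat //= -catA.
rewrite -[X in chain_homotopic _ _ _ X]cats0.
apply: chain_homotopic_catl; first exact: valP.
rewrite -/(chain_end t) -st; apply: chain_homotopic_revl; exact: valP.
Qed.

End LevelDeck.

(** * The uniform fundamental group as deck transformations *)

Section Deck.
Context {R : realType} {X : metricType R} {pt : X}.
Implicit Types (x y : Xtilde pt) (g k : delta pt).

Lemma phi_act g x : phi (act g x) = phi x.
Proof. by rewrite /phi coord_act endpoint_cat // delta_valP. Qed.

Lemma act_tadj g d x y : tadj d x y -> tadj d (act g x) (act g y).
Proof. by apply: cover_cat_adj; exact: delta_valP. Qed.

Lemma act_inj g k x : act g x = act k x -> g = k.
Proof.
move=> gk; apply: delta_ext => e.
apply: (@cover_cat_injl _ _ _ _ _ _ (coord e x)); rewrite ?delta_valP //.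
by rewrite -!coord_act gk.
Qed.

Lemma act_transitive x y : phi x = phi y -> exists g, act g x = y.
Proof.
move=> xy.
have lvl e : exists2 u : Xeps pt e, endpoint u = pt &
    cover_cat u (coord e x) = coord e y.
  by apply: cover_cat_transitive; rewrite !endpoint_coord.
pose u e := projT1 (cid2 (lvl e)).
have uP e : endpoint (u e) = pt /\ cover_cat (u e) (coord e x) = coord e y.
  by rewrite /u; case: cid2.
(* Cancellation makes the translating element unique at each level, so the image of [u d] must be
   [u e]. *)
have ulim : inverse_limit (u : prod_topology (Xeps_uniform pt)).
  move=> d e h; have [ud1 ud2] := uP d; have [ue1 ue2] := uP e.
  apply: (@cover_cat_injl _ _ _ _ _ _ (coord e x)) => //.
    by rewrite endpoint_bonding.
  have := bonding_cat h (coord d x) ud1; rewrite ud2 /coord !coordP => <-.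
  by rewrite [RHS]ue2.
have ud : delta_set (Xtilde_mk ulim) by move=> e; case: (uP e).
exists (delta_mk ud); apply: Xtilde_ext => e.
by rewrite coord_act; case: (uP e).
Qed.

Lemma delta_of_phi x : phi x = pt -> exists g : delta pt, act g (base pt) = x.
Proof.
by move=> xE; apply: act_transitive; rewrite xE [LHS]endpointE.
Qed.

Lemma act_path (lX : length_space X) g (a b : R) (c : R -> Xtilde pt) :
  path_on a b c -> path_on a b (act g \o c).
Proof.
move=> /(Xtilde_path_onP lX)[cp ca]; apply/(Xtilde_path_onP lX); split.
  by apply: path_on_eq cp => t _ /=; rewrite phi_act.
by move=> d t tab; apply: filterS (ca d t tab) => t'; exact: act_tadj.
Qed.

(** Translation preserves paths and their projections, hence does not increase [dXt]; the inverse
    gives the other inequality. *)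
Lemma dXt_act (lX : length_space X) g x y : dXt (act g x) (act g y) = dXt x y.
Proof.
have le k z w : (dXt (act k z) (act k w) <= dXt z w)%E.
  apply: le_ereal_inf_tmp => _ [a [b [c [cp ca cb ->]]]].
  rewrite (@path_length_eq _ _ _ _ (@phi R X pt \o c) (@phi R X pt \o (act k \o c))).
    by apply: lifted_dist_le; [exact: act_path|rewrite /= ca|rewrite /= cb].
  by move=> t _ /=; rewrite phi_act.
apply/eqP; rewrite eq_le le /=.
by have := le g^-1%g (act g x) (act g y); rewrite -!actM mulVg !act1.
Qed.

Lemma act_core (lX : length_space X) g x : metric_core pt (act g (base pt)) ->
  metric_core pt x -> metric_core pt (act g x).
Proof.
by move=> gc xc; apply: (metric_core_close gc); rewrite dXt_act.
Qed.

Lemma actV_core (lX : length_space X) g : metric_core pt (act g (base pt)) ->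
  metric_core pt (act g^-1%g (base pt)).
Proof.
rewrite /metric_core /=; rewrite -(dXt_act lX g (act g^-1%g _)).
by rewrite -actM mulgV act1 /dXt lifted_dist_sym.
Qed.

(** The core is a class of points at finite distance from each other and the action is isometric, so
    one point decides. *)
Lemma core_stabilizerP (lX : length_space X) g :
  core_stabilizer pt g <-> metric_core pt (act g (base pt)).
Proof.
split=> [<-|gc].
  by exists (base pt) => //; exact: base_in_core.
apply/seteqP; split=> [_ [x xc <-]|x xc]; first exact: act_core.
exists (act g^-1%g x); last by rewrite -actM mulgV act1.
by apply: act_core => //; exact: actV_core.
Qed.

End Deck.

(** * Homotopy invariance of lifts and the description of [mu] *)

Section HomotopyInvariance.
Context {R : realType} {X : metricType R} {pt : X} (lX : length_space X).

(** Each slice is lifted separately. Nearby slices are uniformly close by compactness of [a, b], so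
    their lifts end at adjacent points over the same point: the end is locally constant in s at each
    level. *)
Lemma homotopy_lift_end (a b : R) (c c' : R -> X) (g g' : R -> Xtilde pt) :
  path_homotopic_in setT a b c c' ->
  is_lift (@phi R X pt) a b c g -> is_lift (@phi R X pt) a b c' g' ->
  g a = g' a -> g b = g' b.
Proof.
move=> [H [Hc _ Ht Hs]] gl g'l ga; have [[ab _] gphi] := gl.
have aab : a \in `[a, b] by rewrite in_itv /= lexx ab.
have bab : b \in `[a, b] by rewrite in_itv /= lexx ab.
have i0 : (0 : R) \in `[0, 1] by rewrite in_itv /= lexx ler01.
have i1 : (1 : R) \in `[0, 1] by rewrite in_itv /= lexx ler01.
have Hnear (t s e : R) : t \in `[a, b] -> s \in `[0, 1] -> 0 < e ->
    exists A B, [/\ nbhs t A, nbhs s B & forall t' s', A t' -> B s' ->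
      t' \in `[a, b] -> s' \in `[0, 1] -> mdist (H (t, s)) (H (t', s')) < e].
  move=> tab s01 e0; move/subspace_continuousP : Hc => /(_ (t, s)) /(_ (conj tab s01)).
  move=> /metricType_numDomainType.cvgrPdist_lt /(_ e e0) [[A B] /= [At Bs] AB].
  exists A, B; split=> // t' s' At' Bs' t'ab s'01.
  exact: (AB (t', s') (conj At' Bs') (conj t'ab s'01)).
have Hpath (s : R) : s \in `[0, 1] -> path_on a b (fun t => H (t, s)).
  move=> s01; apply/path_on_mdist; split=> // t tab e e0.
  have [A [B [At Bs AB]]] := Hnear t s e tab s01 e0.
  near=> t'; apply: AB => //; last by near: t'; apply: withinT.
    by near: t'; apply: cvg_within.
  exact: nbhs_singleton.
have tube (s e : R) : s \in `[0, 1] -> 0 < e ->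
    \forall s' \near within `[0, 1]%classic (nbhs s),
      {in `[a, b], forall t, mdist (H (t, s)) (H (t, s')) < e}.
  move=> s01 e0.
  have /compact_near_coveringP/near_covering_withinP nc := @segment_compact R a b.
  apply: (nc _ (within `[0, 1]%classic (nbhs s))
    (fun s' t => mdist (H (t, s)) (H (t, s')) < e)) => t tab.
  have e2 : 0 < e / 2 by rewrite divr_gt0.
  have [A [B [At Bs AB]]] := Hnear t s (e / 2) tab s01 e2.
  exists (A, B `&` `[0, 1]%classic) => /=.
    split=> //; apply: filterI; first exact: cvg_within.
    exact: withinT.
  move=> [t' s'] /= [At' [Bs' s'01]] t'ab.
  have h1 := AB t' s' At' Bs' t'ab s'01.
  have h2 := AB t' s At' (nbhs_singleton Bs) t'ab s01.
  have := metric_triangle (H (t', s)) (H (t, s)) (H (t', s')).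
  rewrite (metric_sym (H (t', s)) (H (t, s))); lra.
have : forall s : R, exists k : R -> Xtilde pt, s \in `[0, 1] ->
    is_lift (@phi R X pt) a b (fun t => H (t, s)) k /\ k a = g a.
  move=> s; case: (boolP (s \in `[0, 1])) => [s01|_]; last by exists (cst (g a)).
  have [|k k1 k2] := Xtilde_lift lX (Hpath s s01) (x := g a).
    by rewrite gphi // (Hs s s01).1.
  by exists k.
move=> /choice[K KP].
have Kb s : s \in `[0, 1] -> phi (K s b) = c b.
  by move=> s01; have [[_ Kphi] _] := KP s s01; rewrite Kphi // (Hs s s01).2.
have gK : g b = K 0 b.
  suff e : {in `[a, b], g =1 K 0} by exact: e.
  have [K1 K2] := KP 0 i0.
  apply: (Xtilde_lift_unique lX gl) => //; split; first by case: K1.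
  by move=> t tab; have [_ Kphi] := K1; rewrite Kphi // (Ht t tab).1.
have g'K : g' b = K 1 b.
  suff e : {in `[a, b], g' =1 K 1} by exact: e.
  have [K1 K2] := KP 1 i1.
  apply: (Xtilde_lift_unique lX g'l); last by rewrite K2.
  split; first by case: K1.
  by move=> t tab; have [_ Kphi] := K1; rewrite Kphi // (Ht t tab).2.
(* The neighbourhood of s given by [tube] depends on d, so equality is propagated level by level. *)
rewrite gK g'K; apply: Xtilde_ext => d.
suff : {in `[0, 1], forall s, coord d (K 0 b) = coord d (K s b)} by exact.
apply: segment_induction => // s s01.
have [[Ks1 Ks2] Ks3] := KP s s01.
near=> s'; have s'01 : s' \in `[0, 1] by near: s'; apply: withinT.
have [[Ks'1 Ks'2] Ks'3] := KP s' s'01.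
suff -> : coord d (K s b) = coord d (K s' b) by [].
apply: adj_eq; last by rewrite !endpoint_coord !Kb.
apply: (Xtilde_path_close lX Ks1 Ks'1) => //; last first.
  by rewrite Ks3 Ks'3; exact: (adjacency_refl (tadj_adjacency d)).
move=> t tab; rewrite Ks2 // Ks'2 //; move: t tab; near: s'.
exact: tube.
Unshelve. all: by end_near. Qed.

Lemma path_homotopic_refl (a b : R) (c : R -> X) : path_on a b c ->
  path_homotopic_in setT a b c c.
Proof.
move=> [ab /subspace_continuousP cc]; exists (c \o fst); split=> //.
apply/subspace_continuousP => -[t s] [/= tab s01].
apply: cvg_comp (cc t tab) => A /= At.
exists ([set t' | t' \in `[a, b] -> A t'], setT) => /=.
  by split=> //; exact: filterT.
by move=> [t' s'] /= [At' _] [t'ab _]; exact: At'.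
Qed.

(** Homotopy invariance allows [lambda] to be read on a rectifiable representative, whose lift ends
    in the core. Conversely, a path of finite projected length from [base] to its translate projects
    to a rectifiable loop, and freeness of the action identifies g. *)
Lemma muP (g : delta pt) : mu pt g <-> metric_core pt (act g (base pt)).
Proof.
have i1 : (1 : R) \in `[0, 1] by rewrite in_itv /= lexx ler01.
have i0 : (0 : R) \in `[0, 1] by rewrite in_itv /= lexx ler01.
have bphi : phi (base pt) = pt by rewrite [LHS]endpointE.
pose P (A : set (R -> X)) : set (delta pt) :=
  [set g | exists (c : R -> X) (cL : R -> Xtilde pt),
    [/\ A c, is_lift (@phi R X pt) 0 1 c cL, cL 0 = base pt &
        act g (base pt) = cL 1]].
(* A witness keeps [xget] off its default 1, but the chosen value may come from another
   representative of the class. *)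
have lambdaP A k : P A k -> P A (lambda pt A).
  by move=> Pk; rewrite /lambda; exact: (xgetPex 1%g (ex_intro _ k Pk)).
have liftP (c : R -> X) : loops pt c -> exists cL k,
    [/\ is_lift (@phi R X pt) 0 1 c cL, cL 0 = base pt & act k (base pt) = cL 1].
  move=> cl; have [cp c0 c1] := cl; have [|cL cLl cL0] := Xtilde_lift lX cp (x := base pt).
    by rewrite bphi.
  have [|k kE] := @delta_of_phi _ _ _ (cL 1); first by have [_ cLphi] := cLl; rewrite cLphi.
  by exists cL, k.
split=> [[A [[c0 c0l <-] [c [cl c0c] rc]] <-]|gc].
  have [c0L [k0 [c0Ll c0L0 _]]] := liftP _ c0l.
  have [cL [k [cLl cL0 kE]]] := liftP _ cl.
  have [|c' [c'L [[c'l c0c'] c'Ll c'L0 ->]]] := lambdaP (pi1_class pt c0) k.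
    by exists c, cL.
  rewrite -(homotopy_lift_end c0c' c0Ll c'Ll) ?c0L0 //.
  rewrite (homotopy_lift_end c0c c0Ll cLl) ?c0L0 // /metric_core /= -cL0.
  rewrite /dXt lifted_dist_sym; have [cLp cLphi] := cLl.
  apply: le_lt_trans (dXt_le_length cLp _ _ _) _ => //.
  by rewrite (@path_length_eq _ _ _ _ _ c) //; case: rc.
have : (dXt (base pt) (act g (base pt)) < +oo)%E by rewrite /dXt lifted_dist_sym.
move=> /lifted_dist_lt[a [b [k [kp ka kb kl]]]].
have [c [cp c0 c1 cl]] := path_reparam (@phi R X pt) kp (@ltr01 R).
have lc : loops pt (@phi R X pt \o c).
  split; first exact: phi_path.
  - by rewrite /= c0 ka.
  - by rewrite /= c1 kb phi_act.
have rc : rectifiable 0 1 (@phi R X pt \o c).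
  by split; [exact: phi_path|exact: le_lt_trans kl].
have cc : pi1_class pt (@phi R X pt \o c) (@phi R X pt \o c).
  by split=> //; apply: path_homotopic_refl; case: rc.
exists (pi1_class pt (@phi R X pt \o c)).
  by split; [exists (@phi R X pt \o c)|exists (@phi R X pt \o c)].
have cL : is_lift (@phi R X pt) 0 1 (@phi R X pt \o c) c by [].
have [|c' [c'L [[c'l c0c'] c'Ll c'L0 lE]]] :=
    lambdaP (pi1_class pt (@phi R X pt \o c)) g.
  by exists (@phi R X pt \o c), c; split=> //; rewrite ?c0 ?c1 ?ka ?kb.
apply: (@act_inj _ _ _ _ _ (base pt)); rewrite lE -kb -c1.
by apply/esym/(homotopy_lift_end c0c' cL c'Ll); rewrite c0 ka.
Qed.

End HomotopyInvariance.

(** * The isometric free action of [mu] on the core and its quotient *)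

Section MuAction.
Context {R : realType} {X : metricType R} (pt : X) (lX : length_space X).
Context (h : core_metric pt).
Implicit Types (g f : delta pt) (x y : core_space h).

Lemma mu_stabilizer : mu pt = core_stabilizer pt.
Proof.
by apply/seteqP; split=> g /=; rewrite (muP lX) (core_stabilizerP lX).
Qed.

Lemma mu1 : mu pt 1%g.
Proof. by apply/(muP lX); rewrite act1; exact: base_in_core. Qed.

Lemma mu_div f g : mu pt f -> mu pt g -> mu pt (f / g)%g.
Proof.
move=> /(muP lX) fc /(muP lX) gc; apply/(muP lX); rewrite actM.
by apply: (act_core lX) => //; exact: actV_core.
Qed.

Lemma core_actE g x : mu pt g -> core_val (core_act g x) = act g (core_val x).
Proof.
move=> /(muP lX) gc; rewrite /core_val /core_act insubdK // inE.
by apply: act_core => //; exact: core_valP.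
Qed.

Lemma core_act_isometry g x y : mu pt g ->
  mdist (core_act g x) (core_act g y) = mdist x y.
Proof.
by move=> gm; apply: EFin_inj; rewrite !mdist_coreE !core_actE // dXt_act.
Qed.

Lemma core_act_free g x : mu pt g -> core_act g x = x -> g = 1%g.
Proof.
move=> gm gx; apply: (@act_inj _ _ _ _ _ (core_val x)).
by rewrite -core_actE // gx act1.
Qed.

Lemma core_phi_act g x : mu pt g -> core_phi (core_act g x) = core_phi x.
Proof. by move=> gm; rewrite /core_phi core_actE // phi_act. Qed.

(** A deck transformation that takes one core point to another keeps [base] in the core, so it lies
    in [mu]. *)
Lemma mu_orbitP x y : mu_orbit x y <-> core_phi x = core_phi y.
Proof.
split=> [[g gm <-]|xy]; first by rewrite core_phi_act.
have [g gE] := act_transitive xy.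
have gm : mu pt g.
  apply/(muP lX); apply: (@metric_core_close _ _ _ (core_val y)).
    exact: core_valP.
  rewrite -gE dXt_act // /dXt lifted_dist_sym; exact: core_valP.
by exists g => //; apply: core_val_inj; rewrite core_actE.
Qed.

(** Orbits are fibres of a 1-Lipschitz map. *)
Lemma mu_orbit_closed x : closed (mu_orbit x).
Proof.
move=> y yx; apply/mu_orbitP; apply: mdist_positivity.
apply/eqP; rewrite eq_le mdist_ge0 andbT; apply/ler_addgt0Pr => e e0.
have [z [/mu_orbitP -> ]] := yx _ (nbhsx_ballx y e e0).
rewrite ballEmdist /= add0r metric_sym => yz.
exact: le_trans (core_phi_lipschitz _ _) (ltW yz).
Qed.

Lemma mu_quotient_isometry : exists F : set (core_space h) -> X,
  [/\ set_bij (mu_quotient h) [set: X] F,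
      forall x, F (mu_orbit x) = core_phi x &
      forall x y, mdist (F (mu_orbit x)) (F (mu_orbit y)) = mu_quotient_dist x y].
Proof.
(* The representative picked by [xget] is immaterial, orbits being fibres of [core_phi]. *)
pose F (A : set (core_space h)) : X := core_phi (xget (core_base h) A).
have FE x : F (mu_orbit x) = core_phi x.
  have : mu_orbit x x by apply/mu_orbitP.
  by move=> /(xgetI (core_base h))/mu_orbitP ->.
exists F; split=> //.
  split=> //.
    move=> A B; rewrite !inE => -[x _ <-] [y _ <-]; rewrite !FE => xy.
    by apply/seteqP; split=> z /mu_orbitP zE; apply/mu_orbitP; rewrite -zE xy.
  move=> x _; have [|z zx _] := @core_phi_surjective _ _ _ lX h x (core_base h)
    (mdist (core_phi (core_base h)) x + 1); first by rewrite ltrDl.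
  by exists (mu_orbit z); [exists z|rewrite FE].
move=> x y; rewrite !FE; apply/eqP; rewrite eq_le; apply/andP; split.
  apply: lb_le_inf; first by exists (mdist (core_act 1%g x) y); exists 1%g => //; exact: mu1.
  move=> _ [g gm <-]; rewrite -(core_phi_act x gm); exact: core_phi_lipschitz.
(* Lifting an almost shortest path of [X] from y reaches the orbit of x at a distance exceeding that
   of the projections by less than e. *)
apply/ler_addgt0Pr => e e0.
have [|z zx yz] := @core_phi_surjective _ _ _ lX h (core_phi x) y
  (mdist (core_phi x) (core_phi y) + e).
  by rewrite metric_sym ltrDl.
have /mu_orbitP[g gm gx] := esym zx.
apply: le_trans (ltW yz); apply: ge_inf.
  by exists 0 => _ [k _ <-]; exact: mdist_ge0.
by exists g => //; rewrite gx metric_sym.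
Qed.

End MuAction.

Theorem theorem54 (R : realType) (X : metricType R) (pt : X) :
  length_space X ->
  exists h : core_metric pt,
    length_space (core_space h) /\
    (* (1) *)
    unif_continuous (@core_val R X pt h) /\
    (* (2) *)
    (forall (Y : metricType R) (g : Y -> Xtilde pt),
       length_space Y -> continuous g ->
       (exists y : Y, metric_core pt (g y)) ->
       one_lipschitz (fun y : Y => phi (g y)) ->
       exists g' : Y -> core_space h,
         [/\ forall y : Y, core_val (g' y) = g y, one_lipschitz g' &
             continuous g']) /\
    (* (3) *)
    ((forall (a b T : R) (H : R * R -> X) (x0 : core_space h),
        lipschitz_homotopy a b T H ->
        rectifiable a b (fun t : R => H (t, 0)) ->
        rectifiable a b (fun t : R => H (t, T)) ->
        core_phi x0 = H (a, 0) ->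
        exists HL : R * R -> core_space h,
          is_homotopy_lift (@core_phi R X pt h) a b T H HL /\ HL (a, 0) = x0) /\
     URL_over (H_L pt) (@core_phi R X pt h) (core_base h) pt) /\
    (* (4) *)
    (complete_space X -> complete_space (core_space h)) /\
    (* (5) *)
    [/\ mu pt = core_stabilizer pt,
        mu pt 1%g /\ (forall f g : delta pt, mu pt f -> mu pt g -> mu pt (f / g)%g),
        forall g : delta pt, mu pt g -> forall x y : core_space h,
          core_val (core_act g x) = act g (core_val x) /\
          mdist (core_act g x) (core_act g y) = mdist x y,
        forall (g : delta pt) (x : core_space h),
          mu pt g -> core_act g x = x -> g = 1%g &
        (forall x : core_space h, closed (mu_orbit x)) /\
        exists F : set (core_space h) -> X,
          [/\ set_bij (mu_quotient h) [set: X] F,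
              forall x : core_space h, F (mu_orbit x) = core_phi x &
              forall x y : core_space h,
                mdist (F (mu_orbit x)) (F (mu_orbit y)) = mu_quotient_dist x y]].
Proof.
move=> lX; exists (dXt_core_metric pt lX).
split; first exact: core_length_space.
split; first exact: core_val_unif_continuous.
split; first by move=> Y g; exact: lipschitz_into_core.
split.
  split.
    move=> a b T H x0 HH _ _ x0E.
    have [HL [HLo HLphi HLlip]] := lipschitz_homotopy_lift lX HH x0E.
    exists HL; split=> //; split=> //.
    exact: lipschitz_rectangle_continuous.
  split; first exact: core_phi_URL.
    by rewrite [LHS]endpointE.
  by move=> a b c cL; exact: (H_L_lift_loop lX).
split; first exact: core_complete.
split.
- exact: mu_stabilizer.
- by split; [exact: mu1|exact: mu_div].
- by move=> g gm x y; rewrite core_actE // core_act_isometry.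
- by move=> g x; exact: core_act_free.
- by split; [exact: mu_orbit_closed|exact: mu_quotient_isometry].
Qed.
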